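(* Let $(S,\omega)$ be a connected symplectic manifold with universal cover $\widetilde S$, and let $\phi\in\mathrm{Aut}(\pi_1(S))$ with class $[\phi]\in\mathrm{OutAut}(\pi_1(S))$. The bimodule $\widetilde S\times_{\pi_1(S)}\overline{\widetilde S}$ associated with $[\phi]$ admits a bisection if and only if there is a diffeomorphism $\Phi:S\to S$ such that $\phi=\Phi_*$ (as outer automorphisms of $\pi_1(S)$). It admits a Lagrangian bisection if and only if there is a symplectic diffeomorphism $\Phi:S\to S$ such that $\phi=\Phi_*$ (as outer automorphisms).
   Context: $\mathrm{OutAut}(\pi_1(S))$ is the group of automorphisms of $\pi_1(S)$ modulo inner automorphisms. A diffeomorphism $\Phi$ of $S$ induces $\Phi_*$ on $\pi_1(S)$, well defined as an outer automorphism. $\overline{\widetilde S}$ is $\widetilde S$ with the opposite symplectic form. The bimodule associated with $[\phi]$ is the quotient $\widetilde S\times_{\pi_1(S)}\overline{\widetilde S}$ of $\widetilde S\times\overline{\widetilde S}$ by the action $\gamma\cdot(m,n)=(\gamma\cdot m,\phi(\gamma)\cdot n)$ of $\pi_1(S)$ (deck transformations), with the induced symplectic form and with the two maps to $S$ induced by the projections $\mathrm{pr}_1,\mathrm{pr}_2$. A bisection of this bimodule is an embedded submanifold on which both maps to $S$ restrict to diffeomorphisms onto $S$; it is a Lagrangian bisection if moreover the symplectic form pulls back to zero on it. *)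

(* Defs.v *)
From HB Require Import structures.
From mathcomp Require Import all_boot all_order all_algebra.
From mathcomp Require Import generic_quotient.
From mathcomp Require Import all_classical all_reals all_analysis.
From mathcomp Require Import homotopy lra.

(* All maps between manifolds are plain functions, and a "manifold" is a space
   with an atlas ([charted_space]) satisfying [smooth_manifold]. The quotient of
   a manifold by a group action is built as such a space without proof that it
   satisfies the axioms; it does when the action is smooth, free and properly
   discontinuous. *)

Set Implicit Arguments.
Unset Strict Implicit.
Unset Printing Implicit Defensive.

Import Order.TTheory GRing.Theory Num.Theory.
Import numFieldNormedType.Exports.
Local Open Scope classical_set_scope.
Local Open Scope ring_scope.

Section UnitInterval.
Context {R : realType}.

Definition I01 : Type := [set` `[0%R, 1%R : R]].
HB.instance Definition _ := Topological.on I01.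

Lemma I01_itv (t : I01) : 0 <= set_val t <= 1.
Proof. by have /set_mem := valP t; rewrite /= in_itv. Qed.

Fact proj01_subproof (r : R) : Num.max 0 (Num.min r 1) \in [set` `[0, 1 : R]].
Proof. by apply/mem_set; rewrite /= in_itv /= le_max lexx ge_max ler01 ge_min lexx orbT. Qed.
Definition proj01 (r : R) : I01 := SigSub (proj01_subproof r).

Lemma I01_inj : injective (set_val : I01 -> R).
Proof. exact: val_inj. Qed.

Lemma proj01E (r : R) : 0 <= r <= 1 -> set_val (proj01 r) = r.
Proof. by case/andP=> r0 r1; rewrite set_valE /= (min_idPl r1) (max_idPr r0). Qed.

Lemma proj01K (t : I01) : proj01 (set_val t) = t.
Proof. by apply: I01_inj; rewrite proj01E // I01_itv. Qed.

Lemma proj01_continuous : continuous proj01.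
Proof.
apply: continuous_comp_initial => x.
have -> : set_val \o proj01 = cst 0 \max (id \min cst 1) :> (R -> R^o) by [].
apply: continuous_max; first exact: cst_continuous.
by apply: continuous_min => //; exact: cst_continuous.
Qed.

Lemma I01_val_continuous : continuous (set_val : I01 -> R).
Proof. exact: initial_continuous. Qed.

Fact I01_zero_one_neq : proj01 0 != proj01 1.
Proof.
apply/eqP => /(congr1 set_val); rewrite !proj01E ?lexx ?ler01 //.
by move/eqP; rewrite eq_sym oner_eq0.
Qed.
HB.instance Definition _ := isBiPointed.Build I01 I01_zero_one_neq.
End UnitInterval.
Arguments I01 : clear implicits.

Section Homotopy.
Context {R : realType} {T : topologicalType}.
Notation I := (I01 R).

Lemma glue_continuous (X : topologicalType) (h : X -> R) (f g : X -> T) :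
  continuous h -> continuous f -> continuous g ->
  (forall x, h x = 2^-1 -> f x = g x) ->
  continuous (fun x => if h x <= 2^-1 then f x else g x).
Proof.
move=> hc fc gc fg x A; have [hx|hx|hx] := ltgtP (h x) 2^-1 => xA.
- apply: filterS2 (cvgr_lt _ (hc x) _ hx) (fc x _ xA) => y /ltW hy fy /=.
  by rewrite hy.
- apply: filterS2 (cvgr_gt _ (hc x) _ hx) (gc x _ xA) => y hy gy /=.
  by rewrite leNgt hy.
- have fA : nbhs (f x) A by [].
  have gA : nbhs (g x) A by rewrite -fg.
  have fxA : nbhs x (f @^-1` A) := fc x _ fA.
  have gxA : nbhs x (g @^-1` A) := gc x _ gA.
  by apply: filterS2 fxA gxA => y fy gy /=; case: ifP.
Qed.

Lemma continuous_o (X Y Z : topologicalType) (f : X -> Y) (g : Y -> Z) :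
  continuous f -> continuous g -> continuous (g \o f).
Proof. by move=> cf cg x; apply: continuous_comp; [exact: cf|exact: cg]. Qed.

Lemma continuous_pair (X Y Z : topologicalType) (f : X -> Y) (g : X -> Z) :
  continuous f -> continuous g -> continuous (fun x => (f x, g x)).
Proof. by move=> cf cg x; apply: cvg_pair; [exact: cf|exact: cg]. Qed.

Lemma continuous_fst (X Y : topologicalType) : continuous (@fst X Y).
Proof. by move=> x; exact: cvg_fst. Qed.

Lemma continuous_snd (X Y : topologicalType) : continuous (@snd X Y).
Proof. by move=> x; exact: cvg_snd. Qed.

Lemma mulr_continuous_l (X : topologicalType) (h : X -> R) (a : R) :
  continuous h -> continuous (fun x => a * h x).
Proof.
by move=> ch x; apply: (@continuousM _ _ (cst a) h); [exact: cst_continuous|exact: ch].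
Qed.

Lemma addr_continuous (X : topologicalType) (h k : X -> R) :
  continuous h -> continuous k -> continuous (fun x => h x + k x).
Proof. by move=> ch ck x; apply: (@continuousD _ R^o); [exact: ch|exact: ck]. Qed.

Lemma subr_continuous (X : topologicalType) (h k : X -> R) :
  continuous h -> continuous k -> continuous (fun x => h x - k x).
Proof. by move=> ch ck x; apply: (@continuousB _ R^o); [exact: ch|exact: ck]. Qed.

Definition homotopic (x y : T) (f g : {path I from x to y}) : Prop :=
  exists H : I * I -> T,
    [/\ continuous H,
        forall t, H (zero, t) = f t,
        forall t, H (one, t) = g t &
        forall s, H (s, zero) = x /\ H (s, one) = y].

Definition concat (x y z : T) (f : {path I from x to y})
    (g : {path I from y to z}) (t : I) : T :=
  if set_val t <= 2^-1 then f (proj01 (2 * set_val t))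
  else g (proj01 (2 * set_val t - 1)).

Definition reverse (x y : T) (f : {path I from x to y}) (t : I) : T :=
  f (proj01 (1 - set_val t)).

Lemma fst_half_continuous (X : topologicalType) (h : X -> I) :
  continuous h -> continuous (fun x => proj01 (2 * set_val (h x)) : I).
Proof.
move=> ch; apply: (@continuous_o _ _ _ (fun x => 2 * set_val (h x))); last first.
  exact: proj01_continuous.
by apply: mulr_continuous_l; apply: continuous_o ch _; exact: I01_val_continuous.
Qed.

Lemma snd_half_continuous (X : topologicalType) (h : X -> I) :
  continuous h -> continuous (fun x => proj01 (2 * set_val (h x) - 1) : I).
Proof.
move=> ch; apply: (@continuous_o _ _ _ (fun x => 2 * set_val (h x) - 1)).
  apply: subr_continuous; last exact: cst_continuous.
  by apply: mulr_continuous_l; apply: continuous_o ch _; exact: I01_val_continuous.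
exact: proj01_continuous.
Qed.

Lemma rev_continuous (X : topologicalType) (h : X -> I) :
  continuous h -> continuous (fun x => proj01 (1 - set_val (h x)) : I).
Proof.
move=> ch; apply: (@continuous_o _ _ _ (fun x => 1 - set_val (h x))).
  apply: subr_continuous; first exact: cst_continuous.
  by apply: continuous_o ch _; exact: I01_val_continuous.
exact: proj01_continuous.
Qed.

Lemma val_zero : set_val (zero : I) = 0 :> R.
Proof. by rewrite proj01E // lexx ler01. Qed.

Lemma val_one : set_val (one : I) = 1 :> R.
Proof. by rewrite proj01E // lexx ler01. Qed.

Lemma proj01_zero (r : R) : r = 0 -> proj01 r = zero :> I.
Proof. by move=> ->. Qed.

Lemma proj01_one (r : R) : r = 1 -> proj01 r = one :> I.
Proof. by move=> ->. Qed.

Section Instances.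
Context (x y z : T) (f : {path I from x to y}) (g : {path I from y to z}).

Lemma concat_continuous : continuous (concat f g).
Proof.
apply: glue_continuous; first exact: I01_val_continuous.
- apply: (@continuous_o _ _ _ (fun t : I => proj01 (2 * set_val t))).
    by apply: (@fst_half_continuous _ id) => ?; exact: cvg_id.
  exact: cts_fun.
- apply: (@continuous_o _ _ _ (fun t : I => proj01 (2 * set_val t - 1))).
    by apply: (@snd_half_continuous _ id) => ?; exact: cvg_id.
  exact: cts_fun.
- move=> t tE; rewrite proj01_one ?proj01_zero ?path_one ?path_zero //; lra.
Qed.

Lemma concat_zero : concat f g zero = x.
Proof.
by rewrite /concat val_zero ifT ?mulr0 ?path_zero // invr_ge0 ler0n.
Qed.

Lemma concat_one : concat f g one = z.
Proof.
by rewrite /concat val_one ifF ?proj01_one ?path_one //; [lra|apply/negbTE; lra].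
Qed.

HB.instance Definition _ := isContinuous.Build _ _ (concat f g) concat_continuous.
HB.instance Definition _ :=
  isPath.Build _ _ x z (concat f g) concat_zero concat_one.

Lemma reverse_continuous : continuous (reverse f).
Proof.
apply: (@continuous_o _ _ _ (fun t : I => proj01 (1 - set_val t))).
  by apply: (@rev_continuous _ id) => ?; exact: cvg_id.
exact: cts_fun.
Qed.

Lemma reverse_zero : reverse f zero = y.
Proof. by rewrite /reverse val_zero subr0 path_one. Qed.

Lemma reverse_one : reverse f one = x.
Proof. by rewrite /reverse val_one subrr path_zero. Qed.

HB.instance Definition _ :=
  isContinuous.Build _ _ (reverse f) reverse_continuous.
HB.instance Definition _ :=
  isPath.Build _ _ y x (reverse f) reverse_zero reverse_one.

(* both formulas hold at the midpoint *)
Lemma concatE1 (r : R) : 0 <= r <= 2^-1 ->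
  concat f g (proj01 r) = f (proj01 (2 * r)).
Proof. by move=> r01; rewrite /concat proj01E ?ifT //; lra. Qed.

Lemma concatE2 (r : R) : 2^-1 <= r <= 1 ->
  concat f g (proj01 r) = g (proj01 (2 * r - 1)).
Proof.
move=> r01; rewrite /concat proj01E; last lra.
case: ifPn => // rle; rewrite proj01_one ?proj01_zero ?path_one ?path_zero //; lra.
Qed.

End Instances.

Section HomotopyEquivalence.
Context (x y : T).
Implicit Types f g h : {path I from x to y}.

Lemma homotopic_refl f : homotopic f f.
Proof.
exists (f \o snd); split => //=; last by move=> s; rewrite path_zero path_one.
by apply: continuous_o; [exact: continuous_snd|exact: cts_fun].
Qed.

Lemma homotopic_sym f g : homotopic f g -> homotopic g f.
Proof.
move=> [H [cH H0 H1 He]].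
exists (fun st => H (proj01 (1 - set_val st.1), st.2)); split => /=.
- apply: (@continuous_o _ _ _ (fun st : I * I => (proj01 (1 - set_val st.1), st.2))) => //.
  apply: continuous_pair; last exact: continuous_snd.
  by apply: rev_continuous; exact: continuous_fst.
- by move=> t; rewrite val_zero subr0 H1.
- by move=> t; rewrite val_one subrr H0.
- by move=> s; exact: He.
Qed.

Lemma homotopic_trans f g h : homotopic f g -> homotopic g h -> homotopic f h.
Proof.
move=> [H [cH H0 H1 He]] [K [cK K0 K1 Ke]].
exists (fun st => if set_val st.1 <= 2^-1 then H (proj01 (2 * set_val st.1), st.2)
                  else K (proj01 (2 * set_val st.1 - 1), st.2)); split => /=.
- apply: glue_continuous.
  + by apply: continuous_o I01_val_continuous; exact: continuous_fst.
  + apply: (@continuous_o _ _ _ (fun st : I * I => (proj01 (2 * set_val st.1), st.2))) => //.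
    apply: continuous_pair; last exact: continuous_snd.
    by apply: fst_half_continuous; exact: continuous_fst.
  + apply: (@continuous_o _ _ _ (fun st : I * I => (proj01 (2 * set_val st.1 - 1), st.2))) => //.
    apply: continuous_pair; last exact: continuous_snd.
    by apply: snd_half_continuous; exact: continuous_fst.
  + by move=> [s t] /= sE; rewrite proj01_one ?proj01_zero ?H1 ?K0 //; lra.
- by move=> t; rewrite val_zero ifT ?mulr0 ?H0 // invr_ge0 ler0n.
- by move=> t; rewrite val_one ifF ?proj01_one ?K1 //; [lra|apply/negbTE; lra].
- by move=> s; case: ifP => _; [exact: He|exact: Ke].
Qed.

(* straight-line homotopy between two reparametrizations of the same map *)
Lemma homotopic_reparam (F : I -> T) (a b : I -> R) f g :
  continuous F -> continuous a -> continuous b ->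
  (forall t, f t = F (proj01 (a t))) -> (forall t, g t = F (proj01 (b t))) ->
  a zero = b zero -> a one = b one -> homotopic f g.
Proof.
move=> cF ca cb fE gE ab0 ab1.
exists (fun st => F (proj01 (a st.2 + set_val st.1 * (b st.2 - a st.2)))); split => /=.
- apply: (@continuous_o _ _ _ (fun st : I * I =>
    proj01 (a st.2 + set_val st.1 * (b st.2 - a st.2)) : I)) => //.
  apply: (@continuous_o _ _ _ (fun st : I * I => a st.2 + set_val st.1 * (b st.2 - a st.2))).
    have c2 (k : I -> R) : continuous k -> continuous (fun st : I * I => k st.2).
      by move=> ck; apply: (@continuous_o _ _ _ snd) ck; exact: continuous_snd.
    apply: addr_continuous; first exact: c2.
    move=> st; apply: (@continuousM _ _ (fun st : I * I => set_val st.1)).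
      by apply: (@continuous_o _ _ _ fst) I01_val_continuous st; exact: continuous_fst.
    by apply: subr_continuous; exact: c2.
  exact: proj01_continuous.
- by move=> t; rewrite val_zero mul0r addr0 fE.
- by move=> t; rewrite val_one mul1r addrC subrK gE.
- move=> s; rewrite ab0 ab1 !subrr !mulr0 !addr0 -!gE.
  by rewrite path_zero path_one.
Qed.

End HomotopyEquivalence.

Lemma homotopic_concat (x y z : T) (f f' : {path I from x to y})
    (g g' : {path I from y to z}) :
  homotopic f f' -> homotopic g g' -> homotopic (concat f g) (concat f' g').
Proof.
move=> [H [cH H0 H1 He]] [K [cK K0 K1 Ke]].
exists (fun st => if set_val st.2 <= 2^-1 then H (st.1, proj01 (2 * set_val st.2))
                  else K (st.1, proj01 (2 * set_val st.2 - 1))); split => /=.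
- apply: glue_continuous.
  + by apply: continuous_o I01_val_continuous; exact: continuous_snd.
  + apply: (@continuous_o _ _ _ (fun st : I * I => (st.1, proj01 (2 * set_val st.2)))) => //.
    apply: continuous_pair; first exact: continuous_fst.
    by apply: fst_half_continuous; exact: continuous_snd.
  + apply: (@continuous_o _ _ _ (fun st : I * I => (st.1, proj01 (2 * set_val st.2 - 1)))) => //.
    apply: continuous_pair; first exact: continuous_fst.
    by apply: snd_half_continuous; exact: continuous_snd.
  + move=> [s t] /= tE; rewrite proj01_one ?proj01_zero; [|lra..].
    by rewrite (He s).2 (Ke s).1.
- by move=> t; rewrite H0 K0.
- by move=> t; rewrite H1 K1.
- move=> s; split.
    by rewrite val_zero ifT ?mulr0 ?(He s).1 // invr_ge0 ler0n.
  by rewrite val_one ifF ?proj01_one ?(Ke s).2 //; [lra|apply/negbTE; lra].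
Qed.

Lemma homotopic_reverse (x y : T) (f g : {path I from x to y}) :
  homotopic f g -> homotopic (reverse f) (reverse g).
Proof.
move=> [H [cH H0 H1 He]].
exists (fun st => H (st.1, proj01 (1 - set_val st.2))); split => /=.
- apply: (@continuous_o _ _ _ (fun st : I * I => (st.1, proj01 (1 - set_val st.2)))) => //.
  apply: continuous_pair; first exact: continuous_fst.
  by apply: rev_continuous; exact: continuous_snd.
- by move=> t; rewrite H0.
- by move=> t; rewrite H1.
- move=> s; rewrite val_zero val_one subr0 subrr.
  by split; [exact: (He s).2|exact: (He s).1].
Qed.

Lemma homotopic_concatA (x y z w : T) (f : {path I from x to y})
    (g : {path I from y to z}) (h : {path I from z to w}) :
  homotopic (concat f (concat g h)) (concat (concat f g) h).
Proof.
pose m (r : R) := Num.max (Num.max (2^-1 * r) (r - 4^-1)) (2 * r - 1).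
have cv : continuous (set_val : I -> R) := I01_val_continuous.
have cb : continuous (fun t : I => m (set_val t)).
  have -> : (fun t : I => m (set_val t)) =
    (fun t => 2^-1 * set_val t) \max (fun t => set_val t - 4^-1)
      \max (fun t => 2 * set_val t - 1) :> (I -> R^o) by [].
  move=> t; apply: continuous_max; first apply: continuous_max.
  - exact: mulr_continuous_l.
  - by apply: subr_continuous => //; exact: cst_continuous.
  - by apply: subr_continuous; [exact: mulr_continuous_l|exact: cst_continuous].
apply: (@homotopic_reparam _ _ (concat (concat f g) h) (m \o set_val) set_val) => //.
- exact: cts_fun.
- move=> t; rewrite -[t in LHS]proj01K /=; move: (set_val t) (I01_itv t) => r r01.
  have [r2|r2] := leP r 2^-1.
    have -> : m r = 2^-1 * r by rewrite /m !max_l //; lra.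
    rewrite !concatE1 /= ?concatE1; [|lra..].
    by congr (f (proj01 _)); lra.
  have [r3|r3] := leP r (3 / 4).
    have -> : m r = r - 4^-1 by rewrite /m max_l ?max_r //; lra.
    rewrite concatE2 /= ?concatE1 /= ?concatE2; [|lra..].
    by congr (g (proj01 _)); lra.
  have -> : m r = 2 * r - 1 by rewrite /m max_r // ge_max; apply/andP; split; lra.
  rewrite !concatE2 /= ?concatE2; [|lra..].
  by congr (h (proj01 _)); lra.
- by move=> t; rewrite proj01K.
- by rewrite /= val_zero /m !mulr0 !sub0r max_l ?max_l //; lra.
- by rewrite /= val_one /m max_r ?ge_max; [lra|apply/andP; split; lra].
Qed.

Lemma homotopic_concat1p (x y : T) (f : {path I from x to y}) :
  homotopic (concat (cst x : {path I from x to x}) f) f.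
Proof.
have cv : continuous (set_val : I -> R) := I01_val_continuous.
pose m (r : R) := Num.max 0 (2 * r - 1).
have cb : continuous (fun t : I => m (set_val t)).
  have -> : (fun t : I => m (set_val t)) =
    (cst 0) \max (fun t => 2 * set_val t - 1) :> (I -> R^o) by [].
  move=> t; apply: continuous_max; first exact: cst_continuous.
  by apply: subr_continuous; [exact: mulr_continuous_l|exact: cst_continuous].
apply: (@homotopic_reparam _ _ f (m \o set_val) set_val) => //.
- exact: cts_fun.
- move=> t; rewrite -[t in LHS]proj01K /=; move: (set_val t) (I01_itv t) => r r01.
  have [r2|r2] := leP r 2^-1.
    by rewrite concatE1 /m ?max_l ?path_zero //; lra.
  by rewrite concatE2 /m ?max_r //; lra.
- by move=> t; rewrite proj01K.
- by rewrite /= val_zero /m max_l //; lra.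
- by rewrite /= val_one /m max_r //; lra.
Qed.

Lemma homotopic_concatp1 (x y : T) (f : {path I from x to y}) :
  homotopic (concat f (cst y : {path I from y to y})) f.
Proof.
have cv : continuous (set_val : I -> R) := I01_val_continuous.
pose m (r : R) := Num.min (2 * r) 1.
have cb : continuous (fun t : I => m (set_val t)).
  have -> : (fun t : I => m (set_val t)) =
    (fun t => 2 * set_val t) \min (cst 1) :> (I -> R^o) by [].
  move=> t; apply: continuous_min; last exact: cst_continuous.
  exact: mulr_continuous_l.
apply: (@homotopic_reparam _ _ f (m \o set_val) set_val) => //.
- exact: cts_fun.
- move=> t; rewrite -[t in LHS]proj01K /=; move: (set_val t) (I01_itv t) => r r01.
  have [r2|r2] := leP r 2^-1.
    by rewrite concatE1 /m ?min_l //; lra.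
  by rewrite concatE2 /m ?min_r ?path_one //; lra.
- by move=> t; rewrite proj01K.
- by rewrite /= val_zero /m min_l //; lra.
- by rewrite /= val_one /m min_r //; lra.
Qed.

Lemma homotopic_concatpV (x y : T) (f : {path I from x to y}) :
  homotopic (concat f (reverse f)) (cst x : {path I from x to x}).
Proof.
have cv : continuous (set_val : I -> R) := I01_val_continuous.
pose m (r : R) := Num.min (2 * r) (2 - 2 * r).
have cb : continuous (fun t : I => m (set_val t)).
  have -> : (fun t : I => m (set_val t)) =
    (fun t => 2 * set_val t) \min (fun t => 2 - 2 * set_val t)
    :> (I -> R^o) by [].
  move=> t; apply: continuous_min; first exact: mulr_continuous_l.
  by apply: subr_continuous; [exact: cst_continuous|exact: mulr_continuous_l].
apply: (@homotopic_reparam _ _ f (m \o set_val) (cst 0)) => //.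
- exact: cts_fun.
- exact: cst_continuous.
- move=> t; rewrite -[t in LHS]proj01K /=; move: (set_val t) (I01_itv t) => r r01.
  have [r2|r2] := leP r 2^-1.
    by rewrite concatE1 /m ?min_l //; lra.
  rewrite concatE2 /m /reverse ?min_r; [|lra..].
  by congr (f (proj01 _)); rewrite proj01E; lra.
- by move=> t; rewrite path_zero.
- by rewrite /= val_zero /m min_l //; lra.
- by rewrite /= val_one /m min_r //; lra.
Qed.

Lemma reverseK (x y : T) (f : {path I from x to y}) (t : I) :
  reverse (reverse f) t = f t.
Proof.
rewrite /reverse /= /reverse proj01E; last by have := I01_itv t; lra.
by rewrite opprB addrC subrK proj01K.
Qed.

Lemma homotopic_concatVp (x y : T) (f : {path I from x to y}) :
  homotopic (concat (reverse f) f) (cst y : {path I from y to y}).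
Proof.
have fE : f = reverse (reverse f) :> {path I from x to y}.
  by apply/path_eqP => t; symmetry; exact: reverseK.
by have := homotopic_concatpV (reverse f); rewrite -fE.
Qed.


Section FundamentalGroup.
Context (x : T).
Notation loop := {path I from x to x}.

Definition homotopicb (f g : loop) : bool := `[< homotopic f g >].

Fact homotopicb_equiv : equiv_class_of homotopicb.
Proof.
split=> [f|f g|f g h]; rewrite /homotopicb.
- by apply/asboolP; exact: homotopic_refl.
- by apply/asboolP/asboolP => /homotopic_sym.
- by move=> /asboolP gf /asboolP fh; apply/asboolP; exact: homotopic_trans gf fh.
Qed.
Canonical homotopicb_equiv_rel := EquivRelPack homotopicb_equiv.

End FundamentalGroup.

End Homotopy.

Local Open Scope quotient_scope.

Definition pi1 (R : realType) (T : topologicalType) (x : T) : Type :=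
  {eq_quot (@homotopicb_equiv_rel R T x)}.

Section FundamentalGroupStructure.
Context {R : realType} {T : topologicalType} (x : T).
Notation I := (I01 R).
Notation loop := {path I from x to x}.

HB.instance Definition _ := Choice.on (pi1 R x).
HB.instance Definition _ := EqQuotient.on (pi1 R x).

Definition pi1_class (f : loop) : pi1 R x := \pi f.

Lemma pi1_classP (f g : loop) : pi1_class f = pi1_class g <-> homotopic f g.
Proof.
by split=> [/eqquotP/asboolP //|fg]; apply/eqquotP/asboolP.
Qed.

Lemma pi1_reprK (c : pi1 R x) : pi1_class (repr c) = c.
Proof. exact: reprK. Qed.

Definition pi1_mul (c d : pi1 R x) := pi1_class (concat (repr c) (repr d)).
Definition pi1_inv (c : pi1 R x) := pi1_class (reverse (repr c)).
Definition pi1_one : pi1 R x := pi1_class (cst x).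

Lemma pi1_mulE (f g : loop) :
  pi1_mul (pi1_class f) (pi1_class g) = pi1_class (concat f g).
Proof.
by apply/pi1_classP; apply: homotopic_concat; apply/pi1_classP; exact: pi1_reprK.
Qed.

Lemma pi1_invE (f : loop) : pi1_inv (pi1_class f) = pi1_class (reverse f).
Proof.
by apply/pi1_classP; apply: homotopic_reverse; apply/pi1_classP; exact: pi1_reprK.
Qed.

Fact pi1_mulA : associative pi1_mul.
Proof.
move=> a b c; rewrite -(pi1_reprK a) -(pi1_reprK b) -(pi1_reprK c) !pi1_mulE.
by apply/pi1_classP; exact: homotopic_concatA.
Qed.

Fact pi1_mul1 : left_id pi1_one pi1_mul.
Proof.
move=> a; rewrite -(pi1_reprK a) pi1_mulE.
by apply/pi1_classP; exact: homotopic_concat1p.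
Qed.

Fact pi1_mulr1 : right_id pi1_one pi1_mul.
Proof.
move=> a; rewrite -(pi1_reprK a) pi1_mulE.
by apply/pi1_classP; exact: homotopic_concatp1.
Qed.

Fact pi1_mulV : left_inverse pi1_one pi1_inv pi1_mul.
Proof.
move=> a; rewrite -(pi1_reprK a) pi1_invE pi1_mulE.
by apply/pi1_classP; exact: homotopic_concatVp.
Qed.

Fact pi1_mulrV : right_inverse pi1_one pi1_inv pi1_mul.
Proof.
move=> a; rewrite -(pi1_reprK a) pi1_invE pi1_mulE.
by apply/pi1_classP; exact: homotopic_concatpV.
Qed.

HB.instance Definition _ := isGroup.Build (pi1 R x)
  pi1_mulA pi1_mul1 pi1_mulr1 pi1_mulV pi1_mulrV.

End FundamentalGroupStructure.

Section Calculus.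
Context {R : realType}.

(* C^k on a set U, which is meant to be open. *)
Fixpoint Ck (V W : normedModType R) (k : nat) (f : V -> W) (U : set V) : Prop :=
  match k with
  | 0 => forall x, U x -> {for x, continuous f}
  | k'.+1 => (forall x, U x -> differentiable f x) /\
             forall v, Ck k' ('D_v f) U
  end.

Definition smooth (V W : normedModType R) (f : V -> W) (U : set V) : Prop :=
  forall k, Ck k f U.

End Calculus.

(* [cinv] is only meaningful on the image of the domain *)
Record chart (R : realType) (T : Type) (n : nat) := Chart {
  cdom : set T;
  cmap : T -> 'rV[R]_n;
  cinv : 'rV[R]_n -> T }.

HB.instance Definition _ (R : realType) (T : Type) (n : nat) :=
  gen_eqMixin (chart R T n).
HB.instance Definition _ (R : realType) (T : Type) (n : nat) :=
  gen_choiceMixin (chart R T n).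

Definition is_chart (R : realType) (T : topologicalType) (n : nat)
    (c : chart R T n) : Prop :=
  [/\ open (cdom c),
      open (cmap c @` cdom c),
      forall x, cdom c x -> cinv c (cmap c x) = x,
      forall x, cdom c x -> {for x, continuous (cmap c)} &
      forall y, (cmap c @` cdom c) y -> {for y, continuous (cinv c)}].

(* The data of an atlas on a space; its axioms are [smooth_manifold]. *)
Record charted_space (R : realType) := ChartedSpace {
  carrier :> topologicalType;
  mdim : nat;
  atlas : set (chart R carrier mdim) }.

Section Manifolds.
Context {R : realType}.
Implicit Types M N : charted_space R.

Definition smooth_manifold M : Prop :=
  [/\ hausdorff_space M,
      @second_countable M,
      forall x : M, exists2 c, atlas c & cdom c x,
      forall c, @atlas R M c -> is_chart c &
      forall c c', @atlas R M c -> @atlas R M c' ->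
        smooth (cmap c' \o cinv c) (cmap c @` (cdom c `&` cdom c'))].

(* A chosen chart around x. The tangent space at x is identified with
   'rV_(mdim M) through this chart. *)
Definition chart_at M (x : M) : chart R M (mdim M) :=
  xget (Chart set0 (cst 0) (cst x)) [set c | atlas c /\ cdom c x].

(* U is meant to be open. *)
Definition smooth_on M N (U : set M) (f : M -> N) : Prop :=
  (forall x, U x -> {for x, continuous f}) /\
  forall c c', @atlas R M c -> @atlas R N c' ->
    smooth (cmap c' \o f \o cinv c)
           (cmap c @` (U `&` cdom c `&` f @^-1` cdom c')).

Definition smooth_map M N (f : M -> N) : Prop := smooth_on setT f.

Definition diffeomorphism M N (f : M -> N) : Prop :=
  smooth_map f /\
  exists g : N -> M, [/\ smooth_map g, cancel f g & cancel g f].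

(* The matrix of the differential T_x M -> T_(f x) N, acting on row vectors. *)
Definition mdiff M N (f : M -> N) (x : M) : 'M[R]_(mdim M, mdim N) :=
  jacobian (cmap (chart_at (f x)) \o f \o cinv (chart_at x)) (cmap (chart_at x) x).

Definition smooth_embedding M N (f : M -> N) : Prop :=
  [/\ smooth_map f,
      forall x, row_free (mdiff f x),
      injective f &
      forall U : set M, open U -> exists2 V : set N, open V & f @^-1` V = U].

(* A bilinear form on each T_x M, given by its Gram matrix:
   omega_x(u, v) = u *m omega x *m v^T. *)
Definition two_tensor M := M -> 'M[R]_(mdim M).

Definition pullback M N (f : M -> N) (w : two_tensor N) : two_tensor M :=
  fun x => mdiff f x *m w (f x) *m (mdiff f x)^T.

(* The coefficients of w in the chart c, as a function of the coordinates. *)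
Definition local_coef M (w : two_tensor M) (c : chart R M (mdim M))
    (y : 'rV[R]_(mdim M)) : 'M[R]_(mdim M) :=
  let x := cinv c y in
  let J := jacobian (cmap (chart_at x) \o cinv c) y in
  J *m w x *m J^T.

Definition smooth_form M (w : two_tensor M) : Prop :=
  forall c, atlas c -> smooth (local_coef w c) (cmap c @` cdom c).

Definition closed_form M (w : two_tensor M) : Prop :=
  forall c, atlas c -> forall y, (cmap c @` cdom c) y ->
  forall i j k : 'I_(mdim M),
    let d (a b e : 'I_(mdim M)) : R :=
      'D_(delta_mx 0 a) (fun z => local_coef w c z b e) y in
    d i j k + d j k i + d k i j = 0.

Definition symplectic_form M (w : two_tensor M) : Prop :=
  [/\ forall x, (w x)^T = - w x,
      forall x, w x \in unitmx,
      smooth_form w &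
      closed_form w].

Definition symplectomorphism M N (wM : two_tensor M) (wN : two_tensor N)
    (f : M -> N) : Prop :=
  diffeomorphism f /\ pullback f wN = wM.

Definition prod_chart M N (c : chart R M (mdim M)) (d : chart R N (mdim N)) :
    chart R (M * N)%type (mdim M + mdim N) :=
  Chart (cdom c `*` cdom d)
        (fun x => row_mx (cmap c x.1) (cmap d x.2))
        (fun y => (cinv c (lsubmx y), cinv d (rsubmx y))).

Definition prod_manifold M N : charted_space R :=
  @ChartedSpace R (M * N)%type (mdim M + mdim N)
    [set prod_chart c d | c in @atlas R M & d in @atlas R N].

Definition prod_form M N (wM : two_tensor M) (wN : two_tensor N) :
    two_tensor (prod_manifold M N) :=
  fun z => @pullback (prod_manifold M N) M fst wM z +
           @pullback (prod_manifold M N) N snd wN z.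

Definition opposite_form M (w : two_tensor M) : two_tensor M := fun x => - w x.

End Manifolds.

Section OrbitSpace.
Context {X : Type} {G : Type} (act : G -> X -> X).

Definition orbit_of (x : X) : set X := [set act g x | g in setT].

Definition orbit_space : Type := {A : set X | exists x, A = orbit_of x}.

Definition orbit_pi (x : X) : orbit_space := exist _ (orbit_of x) (ex_intro _ x erefl).
Definition orbit_repr (A : orbit_space) : X := projT1 (cid (projT2 A)).

Fact orbit_reprK : cancel orbit_repr orbit_pi.
Proof.
move=> [A xA]; rewrite /orbit_repr /=; case: cid => x /= Ax.
exact: eq_exist.
Qed.

HB.instance Definition _ := gen_eqMixin orbit_space.
HB.instance Definition _ := gen_choiceMixin orbit_space.
HB.instance Definition _ := isQuotient.Build X orbit_space orbit_reprK.

End OrbitSpace.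

Section QuotientManifold.
Context {R : realType} (M : charted_space R) (G : Type) (act : G -> M -> M).

Definition orbit_topology : topologicalType := quotient_topology (orbit_space act).

Definition orbit_proj (x : M) : orbit_topology := \pi_(orbit_space act) x.

(* The chart obtained from the chart c of M restricted to O, when
   orbit_proj is injective on O. *)
Definition quotient_chart (O : set M) (c : chart R M (mdim M)) :
    chart R orbit_topology (mdim M) :=
  Chart (orbit_proj @` O)
        (fun z => cmap c (xget (repr (z : orbit_space act))
                               [set x | O x /\ orbit_proj x = z]))
        (orbit_proj \o cinv c).

Definition quotient_manifold : charted_space R :=
  @ChartedSpace R orbit_topology (mdim M)
    [set k | exists O c, [/\ atlas c, open O, O `<=` cdom c,
                             {in O &, injective orbit_proj} &
                             k = quotient_chart O c]].

(* The form induced on the quotient by an invariant form w: the one whose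
   pullback along the projection is w. *)
Definition quotient_form (w : two_tensor M) : two_tensor quotient_manifold :=
  xget (fun=> 0)
    [set w' | @pullback R M quotient_manifold orbit_proj w' = w].

End QuotientManifold.
Arguments quotient_form {R M G} act w.

Section Coverings.
Context {R : realType}.
Implicit Types M N : charted_space R.
Notation I := (I01 R).

Definition simply_connected (T : topologicalType) : Prop :=
  (forall x y : T, exists f : {path I from x to y}, True) /\
  forall (x : T) (f : {path I from x to x}), homotopic f (cst x).

Definition smooth_covering M N (p : M -> N) : Prop :=
  [/\ smooth_map p,
      forall y, exists x, p x = y &
      forall y : N, exists U : set N, exists F : set (set M),
        [/\ open U /\ U y,
            forall V, F V -> open V,
            trivIset F id,
            p @^-1` U = \bigcup_(V in F) V &
            forall V, F V -> exists g : N -> M,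
              [/\ smooth_on U g,
                  forall z, U z -> V (g z) /\ p (g z) = z &
                  forall x, V x -> g (p x) = x]]].

Definition universal_covering M N (p : M -> N) : Prop :=
  [/\ smooth_manifold M, simply_connected M & smooth_covering p].

(* For a universal covering p, the deck transformation of M attached to
   c : pi_1(N, p m0): m is joined to m0 by a path a, and c sends it to the
   endpoint of the lift starting at m0 of the path l.(p o a), where l is a loop
   in the class c. With [concat] as product this is a left action. *)
Definition deck M N (p : continuousType M N) (m0 : M) (c : pi1 R (p m0)) (m : M) : M :=
  xget m [set m' | exists (l : {path I from p m0 to p m0})
                          (a : {path I from m0 to m}) (b : {path I from m0 to m'}),
    pi1_class l = c /\ forall t, p (b t) = concat l (p \o a) t].

End Coverings.

(* Equality of two endomorphisms of G up to an inner automorphism. *)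
Definition outer_eq (G : groupType) (f g : G -> G) : Prop :=
  exists a : G, forall c, f c = (a * g c * a^-1)%g.

(* The map induced by f on pi_1(T, x), the base points being matched by a path
   from x to f x; changing the path changes it by an inner automorphism. *)
Definition pi1_map (R : realType) (T : topologicalType) (x : T)
    (f : continuousType T T) (a : {path (I01 R) from x to f x}) (c : pi1 R x) :
    pi1 R x :=
  pi1_class (concat (concat a (f \o repr c)) (reverse a)).

Definition outer_induced (R : realType) (T : topologicalType) (x : T)
    (f : continuousType T T) (phi : pi1 R x -> pi1 R x) : Prop :=
  exists a : {path (I01 R) from x to f x}, outer_eq phi (pi1_map a).

Section Bimodule.
Context {R : realType} {Su S : charted_space R} (p : continuousType Su S).
Context {m0 : Su} (phi : pi1 R (p m0) -> pi1 R (p m0)).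

Definition bimodule_act (c : pi1 R (p m0)) (z : prod_manifold Su Su) :
    prod_manifold Su Su :=
  (deck c z.1, deck (phi c) z.2).

Definition bimodule : charted_space R := quotient_manifold bimodule_act.

Definition bimodule_form (w : two_tensor S) : two_tensor bimodule :=
  quotient_form bimodule_act
    (prod_form (pullback p w) (opposite_form (pullback p w))).

Definition bimodule_left (z : bimodule) : S :=
  p (repr (z : orbit_space bimodule_act)).1.
Definition bimodule_right (z : bimodule) : S :=
  p (repr (z : orbit_space bimodule_act)).2.

End Bimodule.
Arguments bimodule_form {R Su S p m0} phi w.
Arguments bimodule_left {R Su S p m0} phi z.
Arguments bimodule_right {R Su S p m0} phi z.

Section Bisections.
Context {R : realType} {Q S : charted_space R} (l r : Q -> S).

(* The embedded submanifold Sigma is the image of the smooth embedding i of the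
   manifold N. *)
Definition bisection_by (Sigma : set Q) (N : charted_space R) (i : N -> Q) : Prop :=
  [/\ smooth_manifold N, smooth_embedding i, range i = Sigma,
      diffeomorphism (l \o i) & diffeomorphism (r \o i)].

Definition bisection (Sigma : set Q) : Prop :=
  exists N i, @bisection_by Sigma N i.

Definition lagrangian_bisection (w : two_tensor Q) (Sigma : set Q) : Prop :=
  exists N i, @bisection_by Sigma N i /\ forall x, pullback i w x = 0.

End Bisections.

(* Main.v *)
(* A bisection amounts to a smooth section s of the left map whose composite with
   the right map is the diffeomorphism Phi. Writing s(p m) as the class of (m, F m)
   turns s into a lift F of Phi to the universal cover, and s is well defined
   exactly when F(c m) = phi(c) F(m) for all c, which says that phi is induced by
   Phi. The form of the bimodule is left^* w - right^* w, whose pullback along s is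
   w - Phi^* w, so that Lagrangian sections correspond to symplectic Phi. *)

From HB Require Import structures.
Require Import Defs.
From mathcomp Require Import all_boot all_order all_algebra.
From mathcomp Require Import generic_quotient monoid.
From mathcomp Require Import all_classical all_reals all_analysis.
From mathcomp Require Import homotopy lra.

Set Implicit Arguments.
Unset Strict Implicit.
Unset Printing Implicit Defensive.

Import Order.TTheory GRing.Theory Num.Theory.
Import numFieldNormedType.Exports.
Local Open Scope classical_set_scope.
Local Open Scope quotient_scope.
Local Open Scope ring_scope.

(** * Lifting paths and homotopies *)

Section UnitIntervalTopology.
Context {R : realType}.
Notation I := (I01 R).

(** The two directions use different lifts. From a bisection no map of universal covers is built:
    the section sends loops of [S] to the bimodule, where they are lifted to [Su * Su], and a single
    lifted path records the actions of c and of phi(c) at once. Conversely an equivariant lift of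
    [Phi] has to be constructed; the base path and the conjugating element hidden in [outer_induced]
    are both absorbed into its value at [m0]. The obstacle is that the bimodule is only a space with
    an atlas, never shown to satisfy [smooth_manifold]. What is asked of it is reduced to data on
    [Su * Su]: [covered_by_charts] for the calculus, [sheeted] for lifting, and smoothness of deck
    transformations in the place of smooth transition maps. This is also why lifting is proved for
    [sheeted] maps with Hausdorff source instead of [smooth_covering]: it then serves both [p] and
    the orbit projection. As [deck] is defined by a choice operator, uniqueness of lifts and their
    invariance under homotopy must be available before anything can be said about it. *)

Lemma I01_connected : connected [set: I].
Proof.
have -> : [set: I] = proj01 @` `[0%R, 1%R : R].
  apply/seteqP; split=> // t _; exists (set_val t); last exact: proj01K.
  by rewrite /= in_itv /= I01_itv.
apply: connected_continuous_connected; first exact: segment_connected.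
by apply: continuous_subspaceT; exact: proj01_continuous.
Qed.

(** Since [t] and [t'] can be exchanged in [J], the set [P] is both open and closed. This replaces
    the usual subdivision of the interval by a Lebesgue number in all the lifting arguments. *)
Lemma I01_locally_constant (P : I -> Prop) :
  (forall t0, exists2 J, nbhs (t0 : I) J & forall t t', J t -> J t' -> P t -> P t') ->
  forall t0 t, P t0 -> P t.
Proof.
move=> lc t0 t Pt0.
suff PT : P = [set: I] by rewrite PT.
apply: I01_connected; first by exists t0.
- exists P; last by rewrite setTI.
  rewrite openE => s Ps; have [J sJ JP] := lc s.
  have Js := nbhs_singleton sJ.
  by apply: filterS sJ => s' Js'; exact: (JP s).
- exists P; last by rewrite setTI.
  move=> s Ps; have [J sJ JP] := lc s.
  have [s' [Ps' Js']] := Ps _ sJ.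
  by apply: (JP s') => //; exact: nbhs_singleton.
Qed.

Lemma I01_nbhs_ball (t0 : I) (A : set I) : nbhs t0 A ->
  exists2 e : R, 0 < e & forall t : I, `|set_val t0 - set_val t| < e -> A t.
Proof.
move=> t0A.
have /nbhs_ballP[e /= e0 eA] : nbhs (set_val t0 : R) (proj01 @^-1` A).
  by apply: proj01_continuous; rewrite proj01K.
exists e => // t te; rewrite -(proj01K t); exact: (eA (set_val t)).
Qed.

Lemma I01_ball_nbhs (t0 : I) (e : R) : 0 < e ->
  nbhs t0 [set t : I | `|set_val t0 - set_val t| < e].
Proof.
move=> e0.
have : nbhs (set_val t0 : R) (ball (set_val t0 : R) e) by exact: nbhsx_ballx.
exact: (@I01_val_continuous R t0).
Qed.

(** For [a] below [b], the retraction of the interval onto [a, b]. Precomposing with it stands for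
    restricting a path to a subinterval, while the domain remains the whole interval. *)
Definition clamp (a b : I) (t : I) : I :=
  proj01 (Num.max (set_val a) (Num.min (set_val t) (set_val b))).

Lemma clamp_continuous (a b : I) : continuous (clamp a b).
Proof.
apply: (@continuous_o _ _ _
  (fun t : I => Num.max (set_val a) (Num.min (set_val t) (set_val b)))).
  have -> : (fun t : I => Num.max (set_val a) (Num.min (set_val t) (set_val b)))
    = (cst (set_val a)) \max (set_val \min cst (set_val b)) :> (I -> R^o) by [].
  move=> t; apply: continuous_max; first exact: cst_continuous.
  by apply: continuous_min; [exact: I01_val_continuous|exact: cst_continuous].
exact: proj01_continuous.
Qed.

Lemma set_val_clamp (a b t : I) : set_val a <= set_val b ->
  set_val (clamp a b t) = Num.max (set_val a) (Num.min (set_val t) (set_val b)).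
Proof.
move=> ab; rewrite proj01E // le_max ge_max ge_min.
have := I01_itv a; have := I01_itv b; have := I01_itv t.
by move=> /andP[_ ->] /andP[_ _] /andP[-> ->].
Qed.

Lemma clamp_id (a b t : I) : set_val a <= set_val t <= set_val b ->
  clamp a b t = t.
Proof.
case/andP=> at_ tb; apply: I01_inj.
by rewrite set_val_clamp ?(le_trans at_)// min_l // max_r.
Qed.

Lemma set_val_zero_le (t : I) : set_val (zero : I) <= set_val t.
Proof. by rewrite val_zero; case/andP: (I01_itv t). Qed.

Lemma set_val_le_one (t : I) : set_val t <= set_val (one : I).
Proof. by rewrite val_one; case/andP: (I01_itv t). Qed.

Lemma clamp_ball (t0 a b t : I) (e : R) : set_val a <= set_val b ->
  `|set_val t0 - set_val a| < e -> `|set_val t0 - set_val b| < e ->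
  `|set_val t0 - set_val (clamp a b t)| < e.
Proof.
move=> ab ta tb; rewrite set_val_clamp //.
rewrite /Num.min /Num.max; do 2 (case: ifPn => //);
rewrite -?leNgt ?ltr_norml in ta tb * => ? ?; lra.
Qed.

End UnitIntervalTopology.

Lemma near_eq_continuous (T U : topologicalType) (f g : T -> U) (x : T) :
  {near x, f =1 g} -> {for x, continuous g} -> {for x, continuous f}.
Proof.
move=> fg cg A; rewrite (nbhs_singleton fg) => gA.
by apply: filterS2 fg (cg _ gA) => y /= ->.
Qed.

Section Lifting.
Context {R : realType} {X Y : topologicalType}.
Notation I := (I01 R).

(* A weak form of covering map: over a neighbourhood of each point of [Y],
   through every point of the fibre passes a local section that is locally the
   only one. Together with separation of [X] this is all that lifting needs. *)
Definition sheeted (q : X -> Y) : Prop :=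
  forall y, exists2 U, open_nbhs y U &
    forall x, U (q x) -> exists g V,
      [/\ open_nbhs x V,
          forall z, U z -> {for z, continuous g} /\ q (g z) = z &
          forall x', V x' -> U (q x') /\ g (q x') = x'].

Context (q : X -> Y) (sq : sheeted q) (hX : hausdorff_space X).

(** Agreement is locally constant: where the lifts agree, both are recovered nearby from their
    common projection by the same local section; where they differ, disjoint neighbourhoods keep
    them apart. *)
Lemma unique_lift (b1 b2 : I -> X) (t0 : I) :
  continuous b1 -> continuous b2 -> (forall t, q (b1 t) = q (b2 t)) ->
  b1 t0 = b2 t0 -> b1 =1 b2.
Proof.
move=> cb1 cb2 qb bt0 t.
apply: (@I01_locally_constant _ (fun t => b1 t = b2 t) _ t0) => // s0 {t bt0 t0}.
have [U [_ Us0] sU] := sq (q (b1 s0)).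
have [g1 [V1 [/open_nbhs_nbhs xV1 _ gV1]]] := sU _ Us0.
have [E|NE] := pselect (b1 s0 = b2 s0).
- exists (b1 @^-1` V1 `&` b2 @^-1` V1) => /=.
    by apply: filterI; [exact: cb1|apply: cb2; rewrite -E].
  move=> s s' _ [V1s' V2s'] _.
  by rewrite -(gV1 _ V1s').2 -(gV1 _ V2s').2 qb.
- have [[A B] /= [/set_mem As0 /set_mem Bs0] [oA oB AB]] :
    exists2 AB, b1 s0 \in AB.1 /\ b2 s0 \in AB.2 &
                [/\ open AB.1, open AB.2 & AB.1 `&` AB.2 == set0].
    by have := hX; rewrite open_hausdorff; apply; apply/eqP.
  exists (b1 @^-1` A `&` b2 @^-1` B) => /=.
    by apply: filterI; [apply: cb1|apply: cb2]; exact: open_nbhs_nbhs.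
  move=> s s' [As Bs] _ E; exfalso; move/eqP/seteqP: AB => [/(_ (b1 s)) AB _].
  by apply: AB; split => //; rewrite E.
Qed.

(** The times up to which a lift exists form a clopen set: over a sheeted neighbourhood, a lift is
    prolonged by composing the path with the local section through its endpoint. *)
Lemma path_lifting (gam : I -> Y) (x : X) : continuous gam -> q x = gam zero ->
  exists b : I -> X, [/\ continuous b, b zero = x & forall t, q (b t) = gam t].
Proof.
move=> cg qx.
(* the path stopped at time t lifts *)
pose P (t : I) := exists b : I -> X, [/\ continuous b, b zero = x &
   forall s, q (b s) = gam (clamp zero t s)].
suff [b [cb b0 qb]] : P one.
  by exists b; split => // t; rewrite qb clamp_id // set_val_zero_le set_val_le_one.
apply: (@I01_locally_constant _ P _ zero); last first.
  exists (cst x); split => //; first exact: cst_continuous.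
  move=> s; rewrite qx; congr gam; apply: I01_inj.
  by rewrite set_val_clamp // max_l // ge_min lexx orbT.
move=> t0.
have [U [oU Ut0] sU] := sq (gam t0).
have [e e0 eU] : exists2 e : R, 0 < e &
    forall t : I, `|set_val t0 - set_val t| < e -> U (gam t).
  by apply: I01_nbhs_ball; apply: cg; exact: open_nbhs_nbhs.
exists [set t : I | `|set_val t0 - set_val t| < e]; first exact: I01_ball_nbhs.
move=> t1 t2 /= t1e t2e [b [cb b0 qb]].
have cl0 t : clamp zero t zero = zero :> I.
  by apply: clamp_id; rewrite lexx set_val_zero_le.
have clE t s : set_val (clamp zero t s) = Num.min (set_val s) (set_val t) :> R.
  rewrite set_val_clamp ?set_val_zero_le // max_r // le_min.
  by rewrite !set_val_zero_le.
(* Going back in time only requires stopping the given lift earlier. *)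
have [t12|t21] := leP (set_val t1) (set_val t2); last first.
  exists (b \o clamp zero t2); split => /=.
  - by apply: continuous_o cb; exact: clamp_continuous.
  - by rewrite cl0.
  - move=> s; rewrite qb; congr gam; apply: I01_inj; rewrite !clE.
    by rewrite min_l // ge_min (ltW t21) orbT.
have Ut1 : U (q (b one)).
  rewrite qb; apply: eU; rewrite (_ : clamp _ _ _ = t1) //; apply: I01_inj.
  by rewrite clE min_r // set_val_le_one.
have [g [V [/open_nbhs_nbhs bV gU gV]]] := sU _ Ut1.
(* The stopped path is constant after [t1], hence so is its lift by uniqueness. The section [g] was
   chosen through [b one], but the gluing takes place at time [t1]. *)
have bt1 : b t1 = b one.
  have Et : (b \o clamp t1 one) =1 cst (b one).
    apply: (@unique_lift _ _ one).
    - by apply: continuous_o cb; exact: clamp_continuous.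
    - exact: cst_continuous.
    - move=> t /=; rewrite !qb; congr gam; apply: I01_inj; rewrite !clE.
      rewrite set_val_clamp ?set_val_le_one //.
      rewrite [in RHS]min_r ?set_val_le_one // min_r // le_max lexx //.
    - by rewrite /= clamp_id // set_val_le_one lexx.
  by have := Et t1; rewrite /= clamp_id // lexx set_val_le_one.
(* [glue_continuous] only glues at 1/2, hence the shift *)
exists (fun s => if set_val s - set_val t1 + 2^-1 <= 2^-1 then b s
                 else g (gam (clamp t1 t2 s))); split.
- apply: glue_continuous => //.
  + apply: addr_continuous; last exact: cst_continuous.
    by apply: subr_continuous; [exact: I01_val_continuous|exact: cst_continuous].
  + move=> s; apply: (@continuous_comp _ _ _ (gam \o clamp t1 t2) g).
      by apply: (@continuous_o _ _ _ (clamp t1 t2) gam) => //; exact: clamp_continuous.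
    by apply: (gU _ _).1; apply: eU; exact: clamp_ball.
  + move=> s sE; have -> : s = t1 by apply: I01_inj; lra.
    rewrite clamp_id ?lexx // bt1 -(gV (b one) (nbhs_singleton bV)).2.
    congr g; rewrite qb; congr gam; apply: I01_inj.
    by rewrite clE min_r // set_val_le_one.
- rewrite ifT //.
  by have := set_val_zero_le t1; lra.
- move=> s; case: ifPn => [st|].
    rewrite qb; congr gam; apply: I01_inj; rewrite !clE.
    by rewrite !min_l //; lra.
  rewrite -ltNge => st; rewrite (gU _ _).2; last by apply: eU; exact: clamp_ball.
  congr gam; apply: I01_inj; rewrite clE set_val_clamp //.
  by rewrite max_r // le_min; apply/andP; split => //; lra.
Qed.

Lemma homotopy_lifting_end (y0 y1 : Y) (gam del : {path I from y0 to y1})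
    (b c : I -> X) :
  homotopic gam del -> continuous b -> continuous c ->
  (forall t, q (b t) = gam t) -> (forall t, q (c t) = del t) ->
  b zero = c zero -> b one = c one.
Proof.
move=> [H [cH H0 H1 He]] cb cc qb qc bc0.
have cHs s : continuous (fun t => H (s, t)).
  apply: (@continuous_o _ _ _ (fun t => (s, t))) cH.
  by apply: continuous_pair => ?; [exact: cst_continuous|exact: cvg_id].
have cHt t : continuous (fun s => H (s, t)).
  apply: (@continuous_o _ _ _ (fun s => (s, t))) cH.
  by apply: continuous_pair => ?; [exact: cvg_id|exact: cst_continuous].
(* [k s] lifts the [s]-th row. The times at which [k] is continuous in [s] form a
   clopen set, so [k ^~ one] is a path in a fibre, hence constant. *)
have /choice[k kP] s : exists k : I -> X, [/\ continuous k, k zero = b zero &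
    forall t, q (k t) = H (s, t)].
  apply: path_lifting => //.
  by rewrite qb path_zero (He s).1.
have ck1 (s0 : I) : forall t, {for s0, continuous (k ^~ t)}.
  move=> t; apply: (@I01_locally_constant _ (fun t => {for s0, continuous (k ^~ t)}) _ zero); last first.
    have -> : k ^~ zero = cst (b zero) by apply/funext => s; case: (kP s).
    exact: cst_continuous.
  move=> {}t0; have [U [oU Ut0] sU] := sq (H (s0, t0)).
  have [cks0 ks00 qks0] := kP s0.
  have [g [V [kV gU gV]]] : exists g V, [/\ open_nbhs (k s0 t0) V,
      forall z, U z -> {for z, continuous g} /\ q (g z) = z &
      forall x', V x' -> U (q x') /\ g (q x') = x'] by apply: sU; rewrite qks0.
  have HU : nbhs (s0, t0) (H @^-1` U) by apply: cH; exact: open_nbhs_nbhs.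
  have [[W J] /= [s0W t0J] WJ] := HU.
  have [e e0 eJ] : exists2 e : R, 0 < e & forall t : I,
      `|set_val t0 - set_val t| < e -> (J `&` k s0 @^-1` V) t.
    by apply: I01_nbhs_ball; apply: filterI => //; apply: cks0; exact: open_nbhs_nbhs.
  exists [set t : I | `|set_val t0 - set_val t| < e]; first exact: I01_ball_nbhs.
  move=> t1 t2 /= t1e t2e ct1.
  have [Jt1 Vt1] := eJ _ t1e; have [Jt2 Vt2] := eJ _ t2e.
  have WU s t' : W s -> `|set_val t0 - set_val t'| < e -> U (H (s, t')).
    by move=> Ws /eJ[Jt' _]; exact: (WJ (s, t')).
  have nbk : nbhs s0 (k ^~ t1 @^-1` V `&` W).
    apply: filterI => //; apply: ct1.
    by apply: open_nbhs_nbhs; split => //; case: kV.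
  have kE : {near s0, k ^~ t2 =1 fun s => g (H (s, t2))}.
    apply: filterS nbk => s [Vs Ws].
    have [cks _ qks] := kP s.
    (* The propagation goes from [t1] to [t2] in either order, whereas [clamp] needs ordered
       bounds. *)
    pose a : I := if set_val t1 <= set_val t2 then t1 else t2.
    pose a' : I := if set_val t1 <= set_val t2 then t2 else t1.
    have [aa' t1a t2a ae a'e] : [/\ set_val a <= set_val a',
        set_val a <= set_val t1 <= set_val a', set_val a <= set_val t2 <= set_val a',
        `|set_val t0 - set_val a| < e & `|set_val t0 - set_val a'| < e].
      rewrite /a /a'; case: (leP (set_val t1) (set_val t2)) => [t12|/ltW t12];
      by split; rewrite ?lexx ?t12.
    (* Between [t1] and [t2] the row of [s] stays in [U], so [k s] and [g] applied to the row are
       two lifts of it. They agree at [t1] because [k s t1] lies in [V], which holds for [s] near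
       [s0] by the continuity known at [t1]. *)
    have E : k s \o clamp a a' =1 (fun t => g (H (s, clamp a a' t))).
      apply: (@unique_lift _ _ t1).
      - by apply: (continuous_o _ cks); exact: clamp_continuous.
      - move=> u; apply: (@continuous_comp _ _ _ (fun t => H (s, clamp a a' t)) g).
          apply: (@continuous_o _ _ _ (clamp a a') (fun t => H (s, t))) => //.
          exact: clamp_continuous.
        by apply: (gU _ _).1; apply: WU => //; exact: clamp_ball.
      - move=> u /=; rewrite qks (gU _ _).2 //; apply: WU => //; exact: clamp_ball.
      - by rewrite /= clamp_id // -qks (gV _ Vs).2.
    by have := E t2; rewrite /= clamp_id.
  have Ws0 := nbhs_singleton s0W.
  apply: near_eq_continuous kE _.
  apply: (@continuous_comp _ _ _ (fun s => H (s, t2)) g); first exact: cHt.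
  by apply: (gU _ _).1; exact: WU.
have kb t : k zero t = b t.
  have [ckz kz qkz] := kP zero.
  by apply: (@unique_lift _ _ zero) => // s; rewrite qkz H0 qb.
have kc t : k one t = c t.
  have [cko ko qko] := kP one.
  by apply: (@unique_lift _ _ zero) => // [s|]; [rewrite qko H1 qc|rewrite ko].
rewrite -kb -kc.
suff /(_ one)/esym : k ^~ one =1 cst (k zero one) by [].
apply: (@unique_lift _ _ zero) => //.
- by move=> s; exact: ck1.
- exact: cst_continuous.
- move=> s; have [_ _ ->] := kP s; have [_ _ /=->] := kP zero.
  by rewrite (He s).2 (He zero).2.
Qed.

(** Monodromy as a relation: existence and uniqueness of the endpoint become separate lemmas, and
    concatenation and reversal act without choosing lifts. As [gam] is a bare function, its
    endpoints need not match syntactically those of the projected lift. *)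
Definition lift_end (gam : I -> Y) (x x' : X) : Prop :=
  exists b : {path I from x to x'}, forall t, q (b t) = gam t.

Lemma lift_endI (gam : I -> Y) (x x' : X) (b : I -> X) :
  continuous b -> b zero = x -> b one = x' -> (forall t, q (b t) = gam t) ->
  lift_end gam x x'.
Proof. by move=> cb b0 b1 qb; exists (mk_path cb b0 b1). Qed.

Lemma lift_end_comp (x x' : X) (b : {path I from x to x'}) :
  lift_end (q \o b) x x'.
Proof. by exists b. Qed.

Lemma lift_end_eq (gam del : I -> Y) (x x' : X) :
  gam =1 del -> lift_end gam x x' -> lift_end del x x'.
Proof. by move=> gd [b qb]; exists b => t; rewrite qb gd. Qed.

Lemma lift_end_proj (gam : I -> Y) (x x' : X) : lift_end gam x x' ->
  q x = gam zero /\ q x' = gam one.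
Proof. by case=> b qb; rewrite -!qb path_zero path_one. Qed.

Lemma lift_end_total (gam : I -> Y) (x : X) : continuous gam ->
  q x = gam zero -> exists x', lift_end gam x x'.
Proof.
move=> cgam /(path_lifting cgam)[b [cb b0 qb]].
by exists (b one); exact: lift_endI qb.
Qed.

Lemma lift_end_homotopic (y0 y1 : Y) (gam del : {path I from y0 to y1}) (x x' x'' : X) :
  homotopic gam del -> lift_end gam x x' -> lift_end del x x'' -> x' = x''.
Proof.
move=> gd [b qb] [c qc]; rewrite -(path_one (s := b)) -(path_one (s := c)).
apply: homotopy_lifting_end gd _ _ qb qc _; [exact: cts_fun|exact: cts_fun|].
by rewrite !path_zero.
Qed.

Lemma lift_end_fun (gam : I -> Y) (x x' x'' : X) :
  lift_end gam x x' -> lift_end gam x x'' -> x' = x''.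
Proof.
move=> [b qb] [c qc]; rewrite -(path_one (s := b)) -(path_one (s := c)).
apply: (@unique_lift _ _ zero); [exact: cts_fun|exact: cts_fun| |].
- by move=> t; rewrite qb qc.
- by rewrite !path_zero.
Qed.

Lemma lift_end_transfer (y0 y1 : Y) (gam del : {path I from y0 to y1}) (x x' : X) :
  homotopic gam del -> lift_end gam x x' -> lift_end del x x'.
Proof.
move=> gd gx; have [qx _] := lift_end_proj gx.
have [|x'' dx] := @lift_end_total del x (@cts_fun _ _ del).
  by rewrite qx !path_zero.
by rewrite (lift_end_homotopic gd gx dx).
Qed.

Lemma lift_end_concat (y0 y1 y2 : Y) (gam : {path I from y0 to y1})
    (del : {path I from y1 to y2}) (x x' x'' : X) :
  lift_end gam x x' -> lift_end del x' x'' -> lift_end (concat gam del) x x''.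
Proof.
move=> [b qb] [c qc]; exists (concat b c) => t.
by rewrite /= /concat; case: ifP => _; rewrite ?qb ?qc.
Qed.

(** Instead of cutting the given lift in two, the halves are lifted afresh and uniqueness identifies
    the final endpoints. *)
Lemma lift_end_concatP (y0 y1 y2 : Y) (gam : {path I from y0 to y1})
    (del : {path I from y1 to y2}) (x x'' : X) :
  lift_end (concat gam del) x x'' ->
  exists2 x', lift_end gam x x' & lift_end del x' x''.
Proof.
move=> gdx; have [qx _] := lift_end_proj gdx.
have [|x' gx] := @lift_end_total gam x (@cts_fun _ _ gam).
  by rewrite qx !path_zero.
have [|z dz] := @lift_end_total del x' (@cts_fun _ _ del).
  by have [_ ->] := lift_end_proj gx; rewrite path_zero path_one.
exists x' => //; rewrite -(lift_end_fun (lift_end_concat gx dz) gdx) //.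
Qed.

Lemma lift_end_reverse (y0 y1 : Y) (gam : {path I from y0 to y1}) (x x' : X) :
  lift_end gam x x' -> lift_end (reverse gam) x' x.
Proof. by move=> [b qb]; exists (reverse b) => t; rewrite /= /reverse qb. Qed.

Lemma lift_end_cst (x : X) : lift_end (cst (q x)) x x.
Proof. by exists (cst x). Qed.

End Lifting.

(** * Simply connected spaces and the lifting criterion for maps *)

Section SimplyConnected.
Context {R : realType} {X : topologicalType}.
Notation I := (I01 R).

(** Insert the reverse of [g] followed by [g] after [f]: the loop made of [f] and the reverse of [g]
    contracts, and [g] is left. *)
Lemma simply_connected_homotopic (x y : X) (f g : {path I from x to y}) :
  @simply_connected R X -> homotopic f g.
Proof.
move=> [_ sc].
apply: (@homotopic_trans _ _ _ _ _ (concat f (cst y))).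
  by apply: homotopic_sym; exact: homotopic_concatp1.
apply: (@homotopic_trans _ _ _ _ _ (concat f (concat (reverse g) g))).
  apply: homotopic_concat; first exact: homotopic_refl.
  by apply: homotopic_sym; exact: homotopic_concatVp.
apply: homotopic_trans (homotopic_concatA _ _ _) _.
apply: homotopic_trans (homotopic_concat1p _).
by apply: homotopic_concat; [exact: sc|exact: homotopic_refl].
Qed.

Lemma homotopic_comp (Y : topologicalType) (F : continuousType X Y) (x y : X)
    (f g : {path I from x to y}) :
  homotopic f g -> homotopic (F \o f) (F \o g).
Proof.
move=> [H [cH H0 H1 He]]; exists (F \o H); split => /=.
- by apply: continuous_o cH _; exact: cts_fun.
- by move=> t; rewrite H0.
- by move=> t; rewrite H1.
- by move=> s; rewrite (He s).1 (He s).2.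
Qed.

(** The path has to stay in [A] but may leave [B]. This weak form suffices for the continuity of
    lifted maps and follows at once from one chart. *)
Definition locally_path_connected : Prop :=
  forall (x : X) (A : set X), nbhs x A ->
    exists2 B : set X, nbhs x B &
      forall x', B x' -> exists f : {path I from x to x'}, forall t, A (f t).

End SimplyConnected.
Arguments locally_path_connected R X : clear implicits.

Section LiftMap.
Context {R : realType} {X Y Z : topologicalType}.
Notation I := (I01 R).
Context (q : X -> Y) (sq : sheeted q) (hX : hausdorff_space X).

(** [G z] is the endpoint of the lift of [F \o a] for any path [a] to [z], and all such paths are
    homotopic. For continuity at [z], a path is prolonged inside the preimage of a sheeted
    neighbourhood, where its lift is given by the local section [g]; thus [G] is [g \o F] near
    [z]. *)
Lemma map_lifting (F : continuousType Z Y) (z0 : Z) (x0 : X) :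
  @simply_connected R Z -> locally_path_connected R Z -> q x0 = F z0 ->
  exists G : Z -> X, [/\ continuous G, G z0 = x0 & forall z, q (G z) = F z].
Proof.
move=> sc lpc qx0.
have /choice[G GP] z : exists x, forall a : {path I from z0 to z},
    lift_end q (F \o a) x0 x.
  have [a _] := sc.1 z0 z.
  have [|x ax] := @lift_end_total R _ _ q sq hX (F \o a) x0 (@cts_fun _ _ _).
    by rewrite qx0 /= path_zero.
  exists x => a'; apply: lift_end_transfer ax => //.
  by apply: homotopic_comp; exact: simply_connected_homotopic.
have qG z : q (G z) = F z.
  have [a _] := sc.1 z0 z.
  by have [_ ->] := lift_end_proj (GP z a); rewrite /= path_one.
exists G; split => //; last first.
  apply: (lift_end_fun sq hX (GP z0 (cst z0))).
  by apply: (lift_end_eq _ (lift_end_cst q x0)) => t; rewrite /= qx0.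
move=> z; have [U [oU Uz] sU] := sq (q (G z)).
have [g [V [[oV Vz] gU gV]]] := sU _ Uz.
have FU : nbhs z (F @^-1` U).
  by apply: (@cts_fun _ _ F); apply: open_nbhs_nbhs; rewrite -qG.
have [B zB BP] := lpc _ _ FU.
have GE : {near z, G =1 g \o F}.
  apply: filterS zB => z' /BP[f fU].
  have [a _] := sc.1 z0 z.
  apply: (lift_end_fun sq hX (GP z' (concat a f))).
  apply: (@lift_end_eq _ _ _ _ (concat (F \o a) (F \o f))).
    by move=> t; rewrite /= /concat; case: ifP.
  apply: (lift_end_concat (GP z a)).
  apply: (@lift_endI _ _ _ _ _ _ _ (g \o F \o f)).
  - move=> t; apply: (@continuous_comp _ _ _ (F \o f) g).
      exact: (@cts_fun _ _ (F \o f)).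
    by apply: (gU _ _).1; exact: fU.
  - by rewrite /= path_zero -qG (gV _ Vz).2.
  - by rewrite /= path_one.
  - by move=> t; apply: (gU _ _).2; exact: fU.
apply: near_eq_continuous GE _.
apply: (@continuous_comp _ _ _ F g); first exact: cts_fun.
by apply: (gU _ _).1; rewrite -qG.
Qed.

Lemma unique_map_lift (G1 G2 : Z -> X) (z0 : Z) : @simply_connected R Z ->
  continuous G1 -> continuous G2 -> (forall z, q (G1 z) = q (G2 z)) ->
  G1 z0 = G2 z0 -> G1 =1 G2.
Proof.
move=> sc cG1 cG2 qG G0 z; have [a _] := sc.1 z0 z.
have ca : continuous a := @cts_fun _ _ a.
have := @unique_lift R _ _ _ sq hX (G1 \o a) (G2 \o a) zero.
move=> /(_ (continuous_o ca cG1) (continuous_o ca cG2)) /=.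
rewrite path_zero => /(_ (fun t => qG _) G0 one) /=.
by rewrite path_one.
Qed.

End LiftMap.

(** * Germs of smooth maps *)

Section NearDifferentiable.
Context {R : realType} {V W : normedModType R}.

Lemma near_eq_is_diff (f g : V -> W) (x : V) :
  {near x, f =1 g} -> differentiable f x ->
  differentiable g x /\ 'd g x = 'd f x :> (V -> W).
Proof.
move=> fg df.
have dfc := diff_continuous df.
have fgx := nbhs_singleton fg.
have dg : g \o shift x = cst (g x) + 'd f x +o_ 0 id.
  apply/eqaddoP => _/posnumP[e].
  have /eqaddoP/(_ _ [gt0 of e%:num]) := diff_locally df.
  have : \forall h \near 0, f (h + x) = g (h + x).
    by move: fg; rewrite (near_shift 0) => fg; apply: filterS fg => h /=; rewrite subr0.
  move=> fg0; apply: filterS2 fg0 => h fgh; rewrite -fgx.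
  by congr (_ <= _); congr (`| _ |); rewrite !fctE /= fgh.
have dE : 'd g x = 'd f x :> (V -> W) by exact: diff_unique.
by split=> //; apply/diff_locallyP; rewrite dE.
Qed.

End NearDifferentiable.

Section Scale.
Context {R : realType} {V W : normedModType R}.

Lemma scale_is_bilinear :
  bilinear_for (GRing.Scale.Law.clone _ _ *:%R _) (GRing.Scale.Law.clone _ _ *:%R _)
    (@GRing.scale R W : R^o -> W -> W).
Proof.
split=> [u'|u] a x y /=.
- by rewrite scalerDl scalerA.
- by rewrite scalerDr !scalerA mulrC.
Qed.

Definition scale_bilinear := @GRing.scale R W : R^o -> W -> W.
HB.instance Definition _ := bilinear_isBilinear.Build R R^o W W _ _ scale_bilinear
  scale_is_bilinear.

(** The product rule, read off the differential of the continuous bilinear map [scale_bilinear]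
    composed with a pairing. It is what the higher-order chain rule consumes. *)
Lemma is_diff_scalef (a : V -> R^o) (G : V -> W) (x : V) :
  differentiable a x -> differentiable G x ->
  differentiable (fun y => a y *: G y) x /\
  forall v, 'D_v (fun y => a y *: G y) x = a x *: 'D_v G x + 'D_v a x *: G x.
Proof.
move=> da dG.
have cs : continuous (fun p : R^o * W => scale_bilinear p.1 p.2).
  exact: scale_continuous.
have dp := differentiable_pair da dG.
have db := differentiable_bilin (a x, G x) cs.
have d : differentiable (fun y => a y *: G y) x.
  exact: (differentiable_comp dp db).
split=> // v; rewrite !deriveE //.
have -> : (fun y => a y *: G y) =
  (fun p : R^o * W => scale_bilinear p.1 p.2) \o (fun y => (a y, G y)) by [].
by rewrite diff_comp // diff_bilin //= diff_pair.
Qed.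

End Scale.

Section CkGerm.
Context {R : realType}.

(* Pointwise form of [Ck], for which restriction and composition need no open sets. *)
Fixpoint Ckg (V W : normedModType R) (k : nat) (f : V -> W) (x : V) : Prop :=
  match k with
  | 0 => \forall y \near x, {for y, continuous f}
  | k'.+1 => (\forall y \near x, differentiable f y) /\
             forall v, Ckg k' ('D_v f) x
  end.

Definition smoothg (V W : normedModType R) (f : V -> W) (x : V) : Prop :=
  forall k, Ckg k f x.

Lemma CkP (V W : normedModType R) (k : nat) (f : V -> W) (U : set V) : open U ->
  Ck k f U <-> forall x, U x -> Ckg k f x.
Proof.
move=> oU; elim: k f => [|k IH] f; split => /=.
- move=> cf x Ux; have Ux' : nbhs x U by exact: open_nbhs_nbhs.
  by apply: filterS Ux'.
- by move=> cf x Ux; have := nbhs_singleton (cf x Ux).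
- move=> [df dvf] x Ux; split; last by move=> v; apply/IH: x Ux.
  have Ux' : nbhs x U by exact: open_nbhs_nbhs.
  by apply: filterS Ux'.
- move=> cf; split=> [x Ux|v].
    by have := nbhs_singleton (cf x Ux).1.
  by apply/IH => x Ux; exact: (cf x Ux).2.
Qed.

Lemma smoothP (V W : normedModType R) (f : V -> W) (U : set V) : open U ->
  smooth f U <-> forall x, U x -> smoothg f x.
Proof.
move=> oU; split=> [sf x Ux k|sf k]; first by apply/CkP: x Ux; last exact: sf.
by apply/CkP => // x Ux; exact: sf.
Qed.

(** Equality near [x] is equality near every point close to [x], hence it passes to directional
    derivatives and the induction goes through. *)
Lemma Ckg_near (V W : normedModType R) (k : nat) (f g : V -> W) (x : V) :
  {near x, f =1 g} -> Ckg k f x -> Ckg k g x.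
Proof.
elim: k f g => [|k IH] f g fg /=.
  have gf := nbhs_interior fg; apply: filterS2 gf => y fgy.
  by apply: near_eq_continuous; apply: filterS fgy => z /= ->.
move=> [df dvf]; split.
  have gf := nbhs_interior fg; apply: filterS2 gf df => y fgy.
  by move=> /(near_eq_is_diff fgy)[].
move=> v; apply: IH (dvf v).
have gf := nbhs_interior fg; apply: filterS gf => y fgy.
exact: near_eq_derive.
Qed.

Lemma Ckg_continuous (V W : normedModType R) (k : nat) (f : V -> W) (x : V) :
  Ckg k f x -> \forall y \near x, {for y, continuous f}.
Proof.
case: k => [//|k] [df _].
by apply: filterS df => y; exact: differentiable_continuous.
Qed.

Lemma CkgS (V W : normedModType R) (k : nat) (f : V -> W) (x : V) :
  Ckg k.+1 f x -> Ckg k f x.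
Proof.
elim: k f => [|k IH] f; first exact: Ckg_continuous.
by move=> [df dvf]; split => // v; apply: IH; exact: dvf.
Qed.

Lemma Ckg_cst (V W : normedModType R) (k : nat) (c : W) (x : V) : Ckg k (cst c) x.
Proof.
elim: k c => [|k IH] c /=.
  by apply: filterE => y; exact: cst_continuous.
split; first by apply: filterE => y; exact: differentiable_cst.
move=> v; apply: (Ckg_near _ (IH 0)).
by apply: filterE => y /=; rewrite derive_cst.
Qed.

Lemma CkgD (V W : normedModType R) (k : nat) (f g : V -> W) (x : V) :
  Ckg k f x -> Ckg k g x -> Ckg k (f + g) x.
Proof.
elim: k f g => [|k IH] f g /=.
  move=> cf cg; apply: filterS2 cf cg => y; exact: continuousD.
move=> [df dvf] [dg dvg]; split.
  by apply: filterS2 df dg => y; exact: differentiableD.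
move=> v; apply: (Ckg_near _ (IH _ _ (dvf v) (dvg v))).
apply: filterS2 df dg => y df dg.
by rewrite /= deriveD //; exact: diff_derivable.
Qed.

Lemma Ckg_sum (V W : normedModType R) (k : nat) (n : nat) (f : 'I_n -> V -> W) (x : V) :
  (forall i, Ckg k (f i) x) -> Ckg k (\sum_(i < n) f i) x.
Proof.
move=> cf; elim/big_ind : _ => [|f1 f2 c1 c2|i _]; last exact: cf.
  exact: Ckg_cst.
exact: (CkgD c1 c2).
Qed.

Lemma CkgZ (V W : normedModType R) (k : nat) (a : V -> R^o) (G : V -> W) (x : V) :
  Ckg k a x -> Ckg k G x -> Ckg k (fun y => a y *: G y) x.
Proof.
elim: k a G => [|k IH] a G /=.
  by move=> ca cG; apply: filterS2 ca cG => y; exact: continuousZ.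
move=> [da dva] [dG dvG]; split.
  by apply: filterS2 da dG => y da dG; have [] := is_diff_scalef da dG.
move=> v.
have ca : Ckg k a x by apply: CkgS; split.
have cG : Ckg k G x by apply: CkgS; split.
apply: (Ckg_near _ (CkgD (IH _ _ ca (dvG v)) (IH _ _ (dva v) cG))).
apply: filterS2 da dG => y da dG.
by have [_ ->] := is_diff_scalef da dG.
Qed.

Lemma Ckg_linear (V W W' : normedModType R) (k : nat) (L : {linear W -> W'})
    (f : V -> W) (x : V) :
  continuous L -> Ckg k f x -> Ckg k (L \o f) x.
Proof.
move=> cL; elim: k f => [|k IH] f /=.
  by move=> cf; apply: filterS cf => y cf; apply: continuous_comp cf _; exact: cL.
move=> [df dvf]; split.
  apply: filterS df => y df; apply: differentiable_comp df _.
  exact: linear_differentiable.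
move=> v; apply: (Ckg_near _ (IH _ (dvf v))).
apply: filterS df => y df.
have dL z := linear_differentiable z cL.
rewrite /= !deriveE //; last exact: differentiable_comp.
by rewrite (diff_comp df (dL _)) diff_lin.
Qed.

(** The derivative of [g \o f] along v is the sum over j of the j-th coordinate of ['D_v f] times
    the j-th partial derivative of [g] composed with [f]. The induction hypothesis handles that
    composite; the intermediate row-vector space supplies the finite sum. *)
Lemma Ckg_comp (V W : normedModType R) (n k : nat) (f : V -> 'rV[R]_n)
    (g : 'rV[R]_n -> W) (x : V) :
  Ckg k f x -> Ckg k g (f x) -> Ckg k (g \o f) x.
Proof.
elim: k f g => [|k IH] f g /=.
  move=> cf cg.
  have fg := nbhs_singleton cf _ cg.
  by apply: filterS2 cf fg => y; exact: continuous_comp.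
move=> [df dvf] [dg dvg].
have fg := differentiable_continuous (nbhs_singleton df) dg.
have dgf : \forall y \near x, differentiable (g \o f) y.
  by apply: filterS2 df fg => y; exact: differentiable_comp.
split => // v.
have cf : Ckg k f x by apply: CkgS; split.
pose F := \sum_(j < n) (fun y => ('D_v f y 0 j : R^o) *: 'D_(delta_mx 0 j) g (f y)).
have FC : Ckg k F x.
  apply: Ckg_sum => j; apply: CkgZ; last exact: (IH _ _ cf (dvg _)).
  have @L : {linear 'rV[R]_n -> R^o}.
    by exists (fun N : 'rV[R]_n => N 0 j); do 2![eexists]; do ?[constructor];
     rewrite ?mxE// => ? *; rewrite ?mxE//; move=> ?; rewrite !mxE.
  have -> : (fun y => 'D_v f y 0 j : R^o) = L \o 'D_v f by [].
  by apply: Ckg_linear (dvf v); exact: coord_continuous.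
apply: (Ckg_near _ FC).
apply: filterS2 df fg => y df dgy.
rewrite /= deriveE; last exact: differentiable_comp.
rewrite (diff_comp df dgy) /= -(deriveE v df) (row_sum_delta ('D_v f y)) linear_sum /=.
rewrite /F fct_sumE; apply: eq_bigr => j _.
by rewrite linearZ -deriveE.
Qed.

Lemma smoothg_near (V W : normedModType R) (f g : V -> W) (x : V) :
  {near x, f =1 g} -> smoothg f x -> smoothg g x.
Proof. by move=> fg sf k; exact: Ckg_near fg (sf k). Qed.

Lemma smoothg_comp (V W : normedModType R) (n : nat) (f : V -> 'rV[R]_n)
    (g : 'rV[R]_n -> W) (x : V) :
  smoothg f x -> smoothg g (f x) -> smoothg (g \o f) x.
Proof. by move=> sf sg k; exact: Ckg_comp. Qed.

Lemma smoothg_linear (V W W' : normedModType R) (L : {linear W -> W'})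
    (f : V -> W) (x : V) :
  continuous L -> smoothg f x -> smoothg (L \o f) x.
Proof. by move=> cL sf k; exact: Ckg_linear. Qed.

Lemma smoothg_id (V : normedModType R) (x : V) : smoothg id x.
Proof.
case=> [|k] /=; first by apply: filterE => y; exact: cvg_id.
split; first by apply: filterE => y; exact: ex_diff.
move=> v; apply: (Ckg_near _ (Ckg_cst k v x)).
by apply: filterE => y /=; rewrite derive_id.
Qed.

Lemma smoothg_continuous (V W : normedModType R) (f : V -> W) (x : V) :
  smoothg f x -> {for x, continuous f}.
Proof. by move=> /(_ 0) /nbhs_singleton. Qed.

Lemma smoothg_differentiable (V W : normedModType R) (f : V -> W) (x : V) :
  smoothg f x -> differentiable f x.
Proof. by move=> /(_ 1)[/nbhs_singleton]. Qed.

(** Continuity of [L] is automatic in finite dimension: it is a finite sum of coordinates times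
    fixed vectors. *)
Lemma smoothg_linear_rV (V W : normedModType R) (m : nat) (L : 'rV[R]_m -> W)
    (f : V -> 'rV[R]_m) (x : V) :
  linear L -> smoothg f x -> smoothg (L \o f) x.
Proof.
move=> linL.
pose LM := GRing.isLinear.Build _ _ _ _ _ linL.
pose LL : {linear 'rV[R]_m -> W} := HB.pack L LM.
apply: (@smoothg_linear _ _ _ LL) => u.
have -> : (LL : _ -> _) = (fun u => \sum_(j < m) u 0 j *: LL (delta_mx 0 j)).
  apply/funext => u'; rewrite [in LHS](row_sum_delta u') linear_sum.
  by apply: eq_bigr => j _; rewrite linearZ.
suff S n (F : 'I_n -> 'rV[R]_m -> W) : (forall j, continuous (F j)) ->
    continuous (fun u => \sum_(j < n) F j u).
  by apply: S => j u'; apply: continuousZr_tmp; exact: coord_continuous.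
elim: n F => [|n IH] F cF.
  under eq_fun do rewrite big_ord0; exact: cst_continuous.
under eq_fun do rewrite big_ord_recl.
by move=> u'; apply: continuousD; [exact: cF|exact: IH].
Qed.

Lemma smoothg_row_mx (V : normedModType R) (m n : nat) (f : V -> 'rV[R]_m)
    (g : V -> 'rV[R]_n) (x : V) :
  smoothg f x -> smoothg g x -> smoothg (fun y => row_mx (f y) (g y)) x.
Proof.
move=> sf sg k.
have -> : (fun y => row_mx (f y) (g y)) =
    ((fun u : 'rV[R]_m => row_mx u (0 : 'rV[R]_n)) \o f) +
    ((fun u : 'rV[R]_n => row_mx (0 : 'rV[R]_m) u) \o g).
  by apply/funext => y; rewrite fctE /= add_row_mx addr0 add0r.
by apply: CkgD; apply: smoothg_linear_rV => // a u v;
  rewrite scale_row_mx add_row_mx scaler0 addr0.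
Qed.

Lemma smoothg_lsubmx (V : normedModType R) (m n : nat) (f : V -> 'rV[R]_(m + n)) (x : V) :
  smoothg f x -> smoothg (fun y => lsubmx (f y)) x.
Proof. by apply: smoothg_linear_rV => a u v; rewrite linearP. Qed.

Lemma smoothg_rsubmx (V : normedModType R) (m n : nat) (f : V -> 'rV[R]_(m + n)) (x : V) :
  smoothg f x -> smoothg (fun y => rsubmx (f y)) x.
Proof. by apply: smoothg_linear_rV => a u v; rewrite linearP. Qed.

End CkGerm.

Section Jacobian.
Context {R : realType}.

Lemma jacobian_eq m n (f g : 'rV[R]_m -> 'rV[R]_n) x y :
  'd f x = 'd g y :> ('rV[R]_m -> 'rV[R]_n) -> jacobian f x = jacobian g y.
Proof. move=> fg; apply/row_matrixP => i; rewrite [LHS]rowE [RHS]rowE.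
rewrite [LHS]mul_rV_lin1 [RHS]mul_rV_lin1.
exact: (congr1 (fun h : 'rV[R]_m -> 'rV[R]_n => h (delta_mx 0 i)) fg). Qed.

Lemma jacobian_near m n (f g : 'rV[R]_m -> 'rV[R]_n) x :
  {near x, f =1 g} -> differentiable f x -> jacobian g x = jacobian f x.
Proof. by move=> fg df; apply: jacobian_eq; have [] := near_eq_is_diff fg df. Qed.

Lemma jacobian_comp m n p (f : 'rV[R]_m -> 'rV[R]_n) (g : 'rV[R]_n -> 'rV[R]_p) x :
  differentiable f x -> differentiable g (f x) ->
  jacobian (g \o f) x = jacobian f x *m jacobian g (f x).
Proof.
move=> df dg; apply/row_matrixP => i.
by rewrite row_mul !rowE !mul_rV_lin1 (diff_comp df dg).
Qed.

Lemma jacobian_comp_near m n p (f : 'rV[R]_m -> 'rV[R]_n) (g : 'rV[R]_n -> 'rV[R]_p)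
    (h : 'rV[R]_m -> 'rV[R]_p) x y :
  {near x, g \o f =1 h} -> f x = y -> differentiable f x -> differentiable g y ->
  jacobian h x = jacobian f x *m jacobian g y.
Proof.
move=> gfh <- df dg; rewrite -(jacobian_comp df dg).
by apply: jacobian_near gfh _; exact: differentiable_comp.
Qed.

Lemma jacobian_id m (x : 'rV[R]_m) : jacobian id x = 1%:M.
Proof.
apply/row_matrixP => i; rewrite !rowE mul_rV_lin1 mulmx1.
by rewrite (@diff_lin _ _ _ idfun) // => u; exact: cvg_id.
Qed.

End Jacobian.

(** * Maps smooth at a point *)

Section SmoothAt.
Context {R : realType}.
Implicit Types M N P : charted_space R.

(* Compatibility of the charts is not required: [smooth_map] tests all pairs of
   charts, so composition does not need it; only the smoothness of the identity
   does. This spares us the transition maps of the bimodule. *)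
Definition covered_by_charts M : Prop :=
  (forall x : M, exists2 c, atlas c & cdom c x) /\
  (forall c, @atlas R M c -> is_chart c).

Definition smooth_at M N (f : M -> N) (x : M) : Prop :=
  {for x, continuous f} /\
  forall c c', @atlas R M c -> @atlas R N c' -> cdom c x -> cdom c' (f x) ->
    smoothg (cmap c' \o f \o cinv c) (cmap c x).

Lemma smooth_manifold_covered M : smooth_manifold M -> covered_by_charts M.
Proof. by case. Qed.

Lemma chart_image_nbhs (T : topologicalType) n (c : chart R T n) (x : T) :
  is_chart c -> cdom c x -> nbhs (cmap c x) (cmap c @` cdom c).
Proof. by case=> _ oI _ _ _ cx; apply: open_nbhs_nbhs; split => //; exists x. Qed.

Lemma chart_nbhs (T : topologicalType) n (c : chart R T n) (x : T) (A : set T) :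
  is_chart c -> cdom c x -> nbhs x A ->
  \forall y \near cmap c x,
    [/\ A (cinv c y), cdom c (cinv c y) & cmap c (cinv c y) = y].
Proof.
move=> cc cx xA; have [od oI cK _ cont] := cc.
have ix := chart_image_nbhs cc cx.
have xA' : nbhs (cinv c (cmap c x)) A by rewrite cK.
have := cont _ (nbhs_singleton ix) _ xA' => iA.
apply: filterS2 ix iA => y [x' cx' <-] /=.
by rewrite cK.
Qed.

Lemma chart_image_open (T : topologicalType) n (c : chart R T n) (A : set T) :
  is_chart c -> (forall x, A x -> cdom c x /\ nbhs x A) -> open (cmap c @` A).
Proof.
move=> cc AP; rewrite openE => _ [x Ax <-].
have [cx xA] := AP x Ax.
apply: filterS (chart_nbhs cc cx xA) => y [Ay _ <-].
by exists (cinv c y).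
Qed.

Lemma chart_at_dom M (x : M) : covered_by_charts M ->
  atlas (chart_at x) /\ cdom (chart_at x) x.
Proof.
move=> [cov _]; have [c ac cx] := cov x.
by rewrite /chart_at; case: xgetP => [//|/(_ c)[]].
Qed.

Lemma smooth_at_continuous M N (f : M -> N) x :
  smooth_at f x -> {for x, continuous f}.
Proof. by case. Qed.

Lemma smooth_at_near M N (f g : M -> N) x : covered_by_charts M ->
  {near x, f =1 g} -> smooth_at f x -> smooth_at g x.
Proof.
move=> [_ cM] fg [cf sf]; have gf : {near x, g =1 f} by apply: filterS fg => y ->.
split=> [|c c' ac ac' cx c'x]; first exact: near_eq_continuous gf cf.
have sfx : smoothg (cmap c' \o f \o cinv c) (cmap c x).
  by apply: sf => //; rewrite (nbhs_singleton fg).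
apply: smoothg_near sfx.
by apply: filterS (chart_nbhs (cM c ac) cx fg) => y [/= ->].
Qed.

Lemma smooth_at_comp M N P (f : M -> N) (g : N -> P) x :
  covered_by_charts M -> covered_by_charts N ->
  smooth_at f x -> smooth_at g (f x) -> smooth_at (g \o f) x.
Proof.
move=> [_ cM] [covN cN] [cf sf] [cg sg]; split.
  exact: continuous_comp.
move=> c c'' ac ac'' cx c''x.
have [c' ac' c'x] := covN (f x).
have s1 := sf _ _ ac ac' cx c'x.
have cK : cinv c (cmap c x) = x by have [_ _ ->] := cM _ ac.
have s2 : smoothg (cmap c'' \o g \o cinv c') ((cmap c' \o f \o cinv c) (cmap c x)).
  by rewrite /= cK; exact: sg.
apply: smoothg_near (smoothg_comp s1 s2).
have dN : nbhs x (f @^-1` cdom c').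
  apply: cf; apply: open_nbhs_nbhs; split => //.
  by have [] := cN _ ac'.
apply: filterS (chart_nbhs (cM c ac) cx dN) => y [/= c'y _ _].
by have [_ _ ->] := cN _ ac'.
Qed.

Lemma smooth_onP M N (f : M -> N) (U : set M) :
  covered_by_charts M -> covered_by_charts N -> open U ->
  smooth_on U f <-> forall x, U x -> smooth_at f x.
Proof.
move=> [covM cM] [covN cN] oU.
have oI c c' : atlas c -> atlas c' -> (forall x, U x -> {for x, continuous f}) ->
    open (cmap c @` (U `&` cdom c `&` f @^-1` cdom c')).
  move=> ac ac' cf; apply: chart_image_open => [|x [[Ux cx] c'x]]; first exact: cM.
  split=> //; apply: filterI; first apply: filterI.
  - exact: open_nbhs_nbhs.
  - by apply: open_nbhs_nbhs; split => //; have [] := cM _ ac.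
  - apply: (cf x Ux); apply: open_nbhs_nbhs; split => //.
    by have [] := cN _ ac'.
split=> [[cf sf] x Ux|sf].
  split=> [|c c' ac ac' cx c'x]; first exact: cf.
  have /smoothP := sf c c' ac ac'; apply; first exact: oI.
  by exists x.
have cf x : U x -> {for x, continuous f} by move=> /sf[].
split=> // c c' ac ac'.
by apply/smoothP; [exact: oI|move=> _ [x [[Ux cx] c'x] <-]; apply: (sf x Ux).2].
Qed.

Lemma smooth_mapP M N (f : M -> N) :
  covered_by_charts M -> covered_by_charts N ->
  smooth_map f <-> forall x, smooth_at f x.
Proof.
move=> cM cN; split=> [/(smooth_onP _ cM cN openT) sf x|sf]; first exact: sf.
by apply/(smooth_onP _ cM cN openT) => x _; exact: sf.
Qed.

Lemma smooth_map_continuous M N (f : M -> N) : smooth_map f -> continuous f.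
Proof. by case=> cf _ x; exact: cf. Qed.

Lemma smooth_map_comp M N P (f : M -> N) (g : N -> P) :
  covered_by_charts M -> covered_by_charts N -> covered_by_charts P ->
  smooth_map f -> smooth_map g -> smooth_map (g \o f).
Proof.
move=> cM cN cP /smooth_mapP sf /smooth_mapP sg; apply/smooth_mapP => // x.
by apply: smooth_at_comp; [| |exact: sf|exact: sg].
Qed.

Lemma smooth_at_id M (x : M) : smooth_manifold M -> smooth_at (@id M) x.
Proof.
move=> sM; have [_ _ cov cM tr] := sM.
split=> [|c c' ac ac' cx c'x]; first exact: cvg_id.
have /smoothP := tr c c' ac ac'; apply; last by exists x.
apply: chart_image_open => [|z [cz c'z]]; first exact: cM.
by split=> //; apply: filterI; apply: open_nbhs_nbhs;
   split => //; [have [] := cM c ac|have [] := cM c' ac'].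
Qed.

Lemma smooth_map_id M : smooth_manifold M -> smooth_map (@id M).
Proof.
move=> sM; have cM := smooth_manifold_covered sM.
by apply/smooth_mapP => // x; exact: smooth_at_id.
Qed.

(** Both factors read the middle point in the same chosen chart [chart_at (f x)], so the chain rule
    applies without any transition matrix. *)
Lemma mdiff_comp M N P (f : M -> N) (g : N -> P) x :
  covered_by_charts M -> covered_by_charts N -> covered_by_charts P ->
  smooth_at f x -> smooth_at g (f x) ->
  mdiff (g \o f) x = mdiff f x *m mdiff g (f x).
Proof.
move=> cM cN cP [cf sf] [cg sg].
have [ac cx] := chart_at_dom x cM.
have [ac' c'x] := chart_at_dom (f x) cN.
have [ac'' c''x] := chart_at_dom (g (f x)) cP.
have cK : cinv (chart_at x) (cmap (chart_at x) x) = x by have [_ _ ->] := cM.2 _ ac.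
have s1 := sf _ _ ac ac' cx c'x.
have s2 := sg _ _ ac' ac'' c'x c''x.
have fE : (cmap (chart_at (f x)) \o f \o cinv (chart_at x)) (cmap (chart_at x) x)
   = cmap (chart_at (f x)) (f x) by rewrite /= cK.
have d1 := smoothg_differentiable s1.
have d2 := smoothg_differentiable s2.
apply: jacobian_comp_near fE d1 d2.
have dN : nbhs x (f @^-1` cdom (chart_at (f x))).
  apply: cf; apply: open_nbhs_nbhs; split => //.
  by have [] := cN.2 _ ac'.
apply: filterS (chart_nbhs (cM.2 _ ac) cx dN) => y [/= c'y _ _].
by have [_ _ ->] := cN.2 _ ac'.
Qed.

Lemma mdiff_near M N (f g : M -> N) x : covered_by_charts M -> covered_by_charts N ->
  {near x, f =1 g} -> smooth_at f x -> mdiff g x = mdiff f x.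
Proof.
move=> cM cN fg [cf sf]; rewrite /mdiff -(nbhs_singleton fg).
have [ac cx] := chart_at_dom x cM.
have [ac' c'x] := chart_at_dom (f x) cN.
apply: jacobian_near; last exact: smoothg_differentiable (sf _ _ ac ac' cx c'x).
by apply: filterS (chart_nbhs (cM.2 _ ac) cx fg) => y [/= ->].
Qed.

Lemma mdiff_id M (x : M) : covered_by_charts M -> mdiff (@id M) x = 1%:M.
Proof.
move=> cM; have [ac cx] := chart_at_dom x cM.
rewrite /mdiff -(jacobian_id (cmap (chart_at x) x)).
apply: jacobian_near; last exact: ex_diff.
by apply: filterS (chart_nbhs (cM.2 _ ac) cx filterT) => y [/= _ _ ->].
Qed.

Lemma pullback_comp M N P (f : M -> N) (g : N -> P) (w : two_tensor P) x :
  covered_by_charts M -> covered_by_charts N -> covered_by_charts P ->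
  smooth_at f x -> smooth_at g (f x) ->
  pullback (g \o f) w x = pullback f (pullback g w) x.
Proof.
by move=> *; rewrite /pullback mdiff_comp // trmx_mul !mulmxA.
Qed.

Lemma pullback_near M N (f g : M -> N) (w : two_tensor N) x :
  covered_by_charts M -> covered_by_charts N ->
  {near x, f =1 g} -> smooth_at f x -> pullback g w x = pullback f w x.
Proof.
move=> cM cN fg sf.
by rewrite /pullback (mdiff_near cM cN fg sf) (nbhs_singleton fg).
Qed.

Lemma pullback_id M (w : two_tensor M) x : covered_by_charts M ->
  pullback id w x = w x.
Proof. by move=> cM; rewrite /pullback mdiff_id // mul1mx trmx1 mulmx1. Qed.

(** Straight segments inside a ball of the coordinate space, carried back by the inverse chart. *)
Lemma covered_locally_path_connected M : covered_by_charts M -> locally_path_connected R M.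
Proof.
move=> [cov cM] x A xA; have [c ac cx] := cov x.
have cc := cM c ac.
have /nbhs_ballP[e /= e0 eP] := chart_nbhs cc cx xA.
have [od oI cK ccont cicont] := cc.
exists (cdom c `&` cmap c @^-1` ball (cmap c x) e).
  apply: filterI; first by apply: open_nbhs_nbhs.
  by apply: (ccont x cx); exact: nbhsx_ballx.
move=> x' [cx' ex'].
pose l (t : I01 R) := cmap c x + set_val t *: (cmap c x' - cmap c x).
have lball t : ball (cmap c x) e (l t).
  move: ex'; rewrite -!ball_normE /= => ex'.
  rewrite /l opprD addrA subrr add0r normrN normrZ.
  apply: le_lt_trans ex'; rewrite distrC.
  have /andP[t0 t1] := I01_itv t.
  by rewrite ger0_norm // ler_piMl.
have lc : continuous (cinv c \o l).
  move=> t; apply: (@continuous_comp _ _ _ l (cinv c)).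
    apply: continuousD; first exact: cst_continuous.
    by apply: continuousZr_tmp; exact: I01_val_continuous.
  apply: cicont; have [_ cl E] := eP _ (lball t).
  by exists (cinv c (l t)).
have l0 : (cinv c \o l) zero = x.
  by rewrite /= /l val_zero scale0r addr0 cK.
have l1 : (cinv c \o l) one = x'.
  by rewrite /= /l val_one scale1r addrC subrK cK.
exists (mk_path lc l0 l1) => t.
by have [] := eP _ (lball t).
Qed.

End SmoothAt.

(** * Product manifolds and their projections *)

Section Products.
Context {R : realType}.
Implicit Types M N P : charted_space R.

Lemma prod_chart_is_chart M N (c : chart R M (mdim M)) (d : chart R N (mdim N)) :
  is_chart c -> is_chart d ->
  @is_chart R (prod_manifold M N) (mdim (prod_manifold M N)) (prod_chart c d).
Proof.
move=> [oc oIc cK cc cci] [od oId dK cd cdi]; split=> /=.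
- rewrite openE => -[x y] [/= cx dy]; exists (cdom c, cdom d) => //=.
  by split; apply: open_nbhs_nbhs.
- have -> : [set row_mx (cmap c x.1) (cmap d x.2) | x in cdom c `*` cdom d] =
      lsubmx @^-1` (cmap c @` cdom c) `&` rsubmx @^-1` (cmap d @` cdom d).
    apply/seteqP; split=> [_ [[x y] [/= cx dy] <-]|z /= [[x cx xz] [y dy yz]]].
      by rewrite /= row_mxKl row_mxKr; split; [exists x|exists y].
    by exists (x, y) => //=; rewrite xz yz hsubmxK.
  apply: openI; apply: open_comp => // z _.
    exact: continuous_lsubmx.
  exact: continuous_rsubmx.
- by move=> [x y] [/= cx dy]; rewrite row_mxKl row_mxKr cK ?dK.
- move=> [x y] [/= cx dy].
  have -> : (fun z : M * N => row_mx (cmap c z.1) (cmap d z.2)) = (fun z =>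
      row_mx (cmap c z.1) (0 : 'rV_(mdim N)) + row_mx (0 : 'rV_(mdim M)) (cmap d z.2)).
    by apply/funext => z; rewrite add_row_mx addr0 add0r.
  apply: continuousD.
    apply: (@continuous_comp _ _ _ (cmap c \o fst) (fun u => row_mx u 0)).
      by apply: continuous_comp; [exact: cvg_fst|exact: cc].
    exact/smoothg_continuous/smoothg_row_mx/(fun k => Ckg_cst k _ _)/smoothg_id.
  apply: (@continuous_comp _ _ _ (cmap d \o snd) (fun u => row_mx 0 u)).
    by apply: continuous_comp; [exact: cvg_snd|exact: cd].
  exact/smoothg_continuous/smoothg_row_mx/smoothg_id/(fun k => Ckg_cst k _ _).
- move=> _ [[x y] [/= cx dy] <-].
  have c1 : {for row_mx (cmap c x) (cmap d y), continuous (cinv c \o lsubmx)}.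
    apply: continuous_comp; first exact: continuous_lsubmx.
    by rewrite row_mxKl; apply: cci; exists x.
  have c2 : {for row_mx (cmap c x) (cmap d y), continuous (cinv d \o rsubmx)}.
    apply: continuous_comp; first exact: continuous_rsubmx.
    by rewrite row_mxKr; apply: cdi; exists y.
  exact: cvg_pair c1 c2.
Qed.

Lemma prod_covered M N : covered_by_charts M -> covered_by_charts N ->
  covered_by_charts (prod_manifold M N).
Proof.
move=> [covM cM] [covN cN]; split=> [[x y]|_ [c ac [d ad <-]]].
  have [c ac cx] := covM x; have [d ad dy] := covN y.
  by exists (prod_chart c d) => //; exists c => //; exists d.
by apply: prod_chart_is_chart; [exact: cM|exact: cN].
Qed.

(** In charts the projection is [lsubmx] followed by a transition map of [M], which is why [M] must
    have compatible charts. *)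
Lemma smooth_at_fst M N (z : prod_manifold M N) : smooth_manifold M ->
  @smooth_at R (prod_manifold M N) M fst z.
Proof.
move=> sM; split; first exact: cvg_fst.
move=> _ c' [c ac [d ad <-]] ac' [cz dz] c'z.
have [_ sid] := smooth_at_id z.1 sM.
have s := sid _ _ ac ac' cz c'z.
have sl : smoothg (fun y : 'rV[R]_(mdim M + mdim N) => lsubmx y)
    (cmap (prod_chart c d) z).
  by apply: smoothg_lsubmx; exact: smoothg_id.
have s' : smoothg (cmap c' \o id \o cinv c) (lsubmx (cmap (prod_chart c d) z)).
  by rewrite row_mxKl.
exact: smoothg_comp sl s'.
Qed.

Lemma smooth_at_snd M N (z : prod_manifold M N) : smooth_manifold N ->
  @smooth_at R (prod_manifold M N) N snd z.
Proof.
move=> sN; split; first exact: cvg_snd.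
move=> _ d' [c ac [d ad <-]] ad' [cz dz] d'z.
have [_ sid] := smooth_at_id z.2 sN.
have s := sid _ _ ad ad' dz d'z.
have sl : smoothg (fun y : 'rV[R]_(mdim M + mdim N) => rsubmx y)
    (cmap (prod_chart c d) z).
  by apply: smoothg_rsubmx; exact: smoothg_id.
have s' : smoothg (cmap d' \o id \o cinv d) (rsubmx (cmap (prod_chart c d) z)).
  by rewrite row_mxKr.
exact: smoothg_comp sl s'.
Qed.

Lemma smooth_at_pair M N P (f : M -> N) (g : M -> P) x :
  smooth_at f x -> smooth_at g x ->
  @smooth_at R M (prod_manifold N P) (fun y => (f y, g y)) x.
Proof.
move=> [cf sf] [cg sg]; split; first exact: cvg_pair.
move=> c _ ac [d ad [e ae <-]] cx [dx ex].
exact: smoothg_row_mx (sf _ _ ac ad cx dx) (sg _ _ ac ae cx ex).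
Qed.

End Products.

(** * Deck transformations *)

Section SmoothCovering.
Context {R : realType} {Su S : charted_space R} (p : continuousType Su S).
Context (cSu : covered_by_charts Su) (cS : covered_by_charts S).
Context (pcov : smooth_covering p).

Lemma covering_section (y : S) : exists2 U : set S, open_nbhs y U &
  forall x, U (p x) -> exists g V,
    [/\ open_nbhs x V, forall z, U z -> smooth_at g z /\ p (g z) = z &
        forall x', V x' -> U (p x') /\ g (p x') = x'].
Proof.
have [_ _ /(_ y)[U [F [[oU Uy] oF tF pU gF]]]] := pcov.
exists U => // x Ux.
have [V FV Vx] : (\bigcup_(V in F) V) x by rewrite -pU.
have [g [sg gV gK]] := gF V FV.
exists g, V; split=> [|z Uz|x' Vx'].
- by split => //; exact: oF.
- split; last by have [] := gV z Uz.
  by apply/(smooth_onP _ cS cSu oU) : z Uz.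
- split; last exact: gK.
  suff : (p @^-1` U) x' by [].
  by rewrite pU; exists V.
Qed.

Lemma covering_sheeted : sheeted p.
Proof.
move=> y; have [U Uy sU] := covering_section y; exists U => // x /sU[g [V [xV gU gV]]].
by exists g, V; split=> // z /gU[[cg _] pg].
Qed.

Lemma covering_smooth_at x : smooth_at p x.
Proof. by have [/(smooth_mapP _ cSu cS)] := pcov. Qed.

(** Near [m] a continuous [G] stays in one sheet, where it equals a smooth local section composed
    with [p \o G]. *)
Lemma smooth_at_lift (M : charted_space R) (G : M -> Su) (m : M) :
  covered_by_charts M -> {for m, continuous G} -> smooth_at (p \o G) m ->
  smooth_at G m.
Proof.
move=> cM cG sF.
have [U [oU Um] sU] := covering_section (p (G m)).
have [g [V [[oV Vm] gU gV]]] := sU _ Um.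
have [sg _] := gU _ Um.
apply: smooth_at_near cM _ (smooth_at_comp cM cS sF sg).
have mV : nbhs m (G @^-1` V) by apply: cG; exact: open_nbhs_nbhs.
by apply: filterS mV => m' /gV[].
Qed.

End SmoothCovering.

Section Deck.
Context {R : realType} {Su S : charted_space R} (p : continuousType Su S) (m0 : Su).
Context (cSu : covered_by_charts Su) (cS : covered_by_charts S).
Context (hSu : hausdorff_space Su) (scSu : @simply_connected R Su).
Context (pcov : smooth_covering p).
Notation I := (I01 R).
Notation G := (pi1 R (p m0)).
Implicit Types (c d : G) (m : Su) (l : {path I from p m0 to p m0}).

Let sp : sheeted p := covering_sheeted cSu cS pcov.

(** The two lifts are homotopic in the simply connected [Su], and [p] pushes the homotopy down.
    Equalities in the fundamental group are proved below by comparing endpoints in this way. *)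
Lemma pi1_class_inj_lift l l' y :
  lift_end p l m0 y -> lift_end p l' m0 y -> pi1_class l = pi1_class l'.
Proof.
move=> [b qb] [b' qb']; apply/pi1_classP.
have [H [cH H0 H1 He]] := homotopic_comp p (simply_connected_homotopic b b' scSu).
have [_] := lift_end_proj (ex_intro _ b qb : lift_end p l m0 y).
rewrite path_one => py.
exists H; split=> // [t|t|s]; rewrite ?H0 ?H1 /= ?qb ?qb' //.
by have [-> ->] := He s.
Qed.

(** The endpoint depends neither on the loop chosen in its class nor on the path to [m], so any
    witness computes the [xget] in [deck]; the given one also rules out the default value. *)
Lemma deck_eq l m m' (a : {path I from m0 to m}) :
  lift_end p (concat l (p \o a)) m0 m' -> deck (pi1_class l) m = m'.
Proof.
move=> E; rewrite /deck; case: xgetP => [m'' _ [l' [a' [b' [ll' pb']]]]|/(_ m')].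
  have E' : lift_end p (concat l' (p \o a')) m0 m'' by exists b'.
  apply: (lift_end_homotopic sp hSu _ E' E).
  apply: homotopic_concat; first exact/pi1_classP.
  by apply: homotopic_comp; exact: simply_connected_homotopic.
by case: E => b pb; case; exists l, a, b.
Qed.

Lemma deck_lift_end l m (a : {path I from m0 to m}) :
  lift_end p (concat l (p \o a)) m0 (deck (pi1_class l) m).
Proof.
have [|m' E] := @lift_end_total R _ _ p sp hSu (concat l (p \o a)) m0 (@cts_fun _ _ _).
  by rewrite path_zero.
by rewrite (deck_eq E).
Qed.

Lemma deck_base l : lift_end p l m0 (deck (pi1_class l) m0).
Proof.
have [m' E E'] := lift_end_concatP sp hSu (deck_lift_end l (cst m0)).
have [_ pm'] := lift_end_proj E.
suff <- : m' = deck (pi1_class l) m0 by [].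
apply: (lift_end_fun sp hSu _ E').
apply: lift_end_eq (lift_end_cst p m') => t.
by rewrite /= pm' path_one.
Qed.

(** The pointwise recipe of [deck] coincides with the continuous lift of [p] through itself that
    sends [m0] to the endpoint of the lifted loop. *)
Lemma deck_lifting c : continuous (deck c) /\ forall m, p (deck c m) = p m.
Proof.
have [l <-] : exists l, pi1_class l = c by exists (repr c); exact: pi1_reprK.
have [|H [cH H0 pH]] := @map_lifting R _ _ _ p sp hSu p m0 (deck (pi1_class l) m0)
    scSu (covered_locally_path_connected cSu).
  by have [_ ->] := lift_end_proj (deck_base l); rewrite path_one.
suff -> : deck (pi1_class l) = H by [].
apply/funext => m; have [a _] := scSu.1 m0 m.
apply: (deck_eq (a := a)).
apply: (lift_end_concat (deck_base l)).
apply: (@lift_endI _ _ _ _ _ _ _ (H \o a)) => //.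
- by apply: continuous_o cH; exact: cts_fun.
- by rewrite /= path_zero.
- by rewrite /= path_one.
- by move=> t; exact: pH.
Qed.

Lemma deck_continuous c : continuous (deck c).
Proof. by have [] := deck_lifting c. Qed.

Lemma deck_proj c m : p (deck c m) = p m.
Proof. by have [] := deck_lifting c. Qed.

Lemma deck_smooth_at c m : smooth_at (deck c) m.
Proof.
apply: (smooth_at_lift cSu cS pcov) => //; first exact: deck_continuous.
have -> : p \o deck c = p by apply/funext => m'; exact: deck_proj.
exact: covering_smooth_at.
Qed.

Lemma deck1 m : deck (1%g : G) m = m.
Proof.
have [a _] := scSu.1 m0 m.
apply: (deck_eq (l := cst (p m0)) (a := a)).
exact: lift_end_concat (lift_end_cst p m0) (lift_end_comp p a).
Qed.

(** A path [b] from [m0] to [deck d m] can be taken over [l'] followed by [p \o a]. Lifting [l]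
    followed by [p \o b] then amounts to lifting three pieces, which only have to be regrouped. *)
Lemma deckM c d m : deck (c * d)%g m = deck c (deck d m).
Proof.
have [l <-] : exists l, pi1_class l = c by exists (repr c); exact: pi1_reprK.
have [l' <-] : exists l', pi1_class l' = d by exists (repr d); exact: pi1_reprK.
have -> : (pi1_class l * pi1_class l')%g = pi1_class (concat l l') by exact: pi1_mulE.
have [a _] := scSu.1 m0 m.
have [b pb] := deck_lift_end l' a.
have [z E1 E2] := lift_end_concatP sp hSu (deck_lift_end l b).
have /(lift_end_concatP sp hSu)[z' E3 E4] := lift_end_eq pb E2.
apply: (deck_eq (a := a)).
by apply: lift_end_concat E4; exact: lift_end_concat E1 E3.
Qed.

(** If [m] is fixed, lifting [p \o a] backwards from [m] ends at [m0], so the lift of the loop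
    closes up at [m0], as does the constant path. *)
Lemma deck_free c m : deck c m = m -> c = 1%g.
Proof.
have [l <-] : exists l, pi1_class l = c by exists (repr c); exact: pi1_reprK.
move=> fix_m; have [a _] := scSu.1 m0 m.
have [y E1 E2] := lift_end_concatP sp hSu (deck_lift_end l a).
rewrite fix_m in E2.
have y0 : m0 = y.
  apply: (lift_end_fun sp hSu (lift_end_reverse (lift_end_comp p a))).
  exact: lift_end_reverse E2.
rewrite -y0 in E1.
exact: pi1_class_inj_lift E1 (lift_end_cst p m0).
Qed.

Lemma deck_transitive m m' : p m = p m' -> exists c, deck c m = m'.
Proof.
move=> pm; have [a _] := scSu.1 m0 m; have [a' _] := scSu.1 m0 m'.
(* The path [p \o a'], retyped along [pm] so that it can be followed by the reverse of [p \o a]; the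
   resulting loop gives the required class. *)
have [g Eg] : exists g : {path I from p m0 to p m}, lift_end p g m0 m'.
  by rewrite pm; exists (p \o a'); exact: lift_end_comp.
have [|z Ez] := @lift_end_total R _ _ p sp hSu (reverse (p \o a)) m' (@cts_fun _ _ _).
  by rewrite path_zero pm.
exists (pi1_class (concat g (reverse (p \o a)))).
apply: (deck_eq (a := a)); apply: (lift_end_concat (lift_end_concat Eg Ez)).
apply: lift_end_eq (lift_end_reverse Ez) => t; exact: reverseK.
Qed.

End Deck.

(** * Quotients by a group action *)

Section QuotientByGroup.
Context {R : realType} {M : charted_space R} {gT : groupType} (act : gT -> M -> M).
Context (cM : covered_by_charts M).
Context (act1 : forall x, act 1%g x = x).
Context (actM : forall g h x, act (g * h)%g x = act g (act h x)).
Context (sact : forall g x, smooth_at (act g) x).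
Context (loc_inj : forall x,
  exists2 W, open_nbhs x W & {in W &, injective (orbit_proj act)}).

Notation Q := (quotient_manifold act).
Notation proj := (orbit_proj act : M -> Q).

Lemma orbit_projP x y : proj x = proj y <-> exists g, act g x = y.
Proof.
have -> : (proj x = proj y) <-> orbit_of act x = orbit_of act y.
  rewrite /orbit_proj !unlock; split => [/(congr1 (@proj1_sig _ _))//|E].
  exact: eq_exist.
split=> [E|[g <-]].
- have : orbit_of act y y by exists 1%g => //; exact: act1.
  by rewrite -E => -[g _ gx]; exists g.
- apply/seteqP; split=> [_ [h _ <-]|_ [h _ <-]].
    by exists (h * g^-1)%g => //; rewrite -actM mulgVK.
  by exists (h * g)%g => //; rewrite actM.
Qed.

Lemma orbit_proj_surj (z : Q) : exists x, proj x = z.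
Proof. by exists (repr (z : orbit_space act)); exact: reprK. Qed.

Lemma orbit_proj_continuous : continuous proj.
Proof. exact: pi_continuous. Qed.

Lemma act_continuous g : continuous (act g).
Proof. by move=> x; case: (sact g x). Qed.

Lemma orbit_proj_open (W : set M) : open W -> open (proj @` W).
Proof.
move=> oO; rewrite /open /= /quotient_open.
have -> : \pi_(quotient_topology (orbit_space act)) @^-1` (proj @` W) =
    \bigcup_(g in [set: gT]) (act g @^-1` W).
  apply/seteqP; split=> [x [y Oy /esym/orbit_projP[g gx]]|x [g _ /= Ogx]].
    by exists g; rewrite //= gx.
  by exists (act g x) => //; apply/esym/orbit_projP; exists g.
apply: bigcup_open => g _; apply: open_comp => // x _; exact: act_continuous.
Qed.

Lemma orbit_proj_nbhs x (A : set M) : nbhs x A -> nbhs (proj x) (proj @` A).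
Proof.
move=> xA; have oA : open (proj @` A°) by apply: orbit_proj_open; exact: open_interior.
have : nbhs (proj x) (proj @` A°).
  by apply: open_nbhs_nbhs; split => //; exists x.
by apply: filterS; apply: image_subset; exact: interior_subset.
Qed.

(** The expression is the one occurring in [quotient_chart], whose coordinate map is thus
    [cmap c \o orbit_section W] by conversion. *)
Definition orbit_section (W : set M) (z : Q) : M :=
  xget (repr (z : orbit_space act)) [set x | W x /\ proj x = z].

Lemma orbit_sectionK (W : set M) x : {in W &, injective (orbit_proj act)} -> W x ->
  orbit_section W (proj x) = x.
Proof.
move=> iO Ox; rewrite /orbit_section; case: xgetP => [y _ [Oy yx]|/(_ x)[]//].
by apply: iO yx; rewrite inE.
Qed.

(** Seen from a representative outside [W], the section is a group translation. Smoothness in the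
    quotient is reduced to that of the action through this fact. *)
Lemma orbit_section_act (W : set M) x g : open W -> {in W &, injective (orbit_proj act)} ->
  W (act g x) -> {near x, orbit_section W \o proj =1 act g}.
Proof.
move=> oO iO Ogx.
have : nbhs x (act g @^-1` W) by apply: act_continuous; exact: open_nbhs_nbhs.
apply: filterS => y /= Ogy.
rewrite -(orbit_sectionK iO Ogy); congr (orbit_section W).
by apply/orbit_projP; exists g.
Qed.

Lemma quotient_covered : covered_by_charts Q.
Proof.
split=> [z|_ [W [c [ac oO Oc iO ->]]]].
  have [x <-] := orbit_proj_surj z.
  have [c ac cx] := cM.1 x; have [W [oO Ox] iO] := loc_inj x.
  (* An injectivity neighbourhood need not lie in a chart domain, hence the intersection. *)
  exists (quotient_chart act (W `&` cdom c) c); last by exists x.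
  exists (W `&` cdom c), c; split=> //.
  - by apply: openI => //; have [] := cM.2 _ ac.
  - move=> y y' /set_mem[Oy _] /set_mem[Oy' _]; apply: iO; exact/mem_set.
have cc := cM.2 _ ac; have [od oI cK ccont ci] := cc.
have cE x : W x -> cmap (quotient_chart act W c) (proj x) = cmap c x.
  by move=> Ox /=; congr (cmap c _); exact: orbit_sectionK.
have iE : [set cmap (quotient_chart act W c) z | z in proj @` W] = cmap c @` W.
  apply/seteqP; split=> [_ [_ [x Ox <-] <-]|_ [x Ox <-]].
    by exists x => //; rewrite cE.
  by exists (proj x); [exists x|rewrite cE].
split=> [| |_ [x Ox <-]|_ [x Ox <-]|].
- exact: orbit_proj_open.
- rewrite [X in open X]iE; apply: chart_image_open => // x Ox.
  by split; [exact: Oc|exact: open_nbhs_nbhs].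
- by rewrite cE //= cK //; exact: Oc.
- move=> A; rewrite [X in nbhs X]cE // => cA.
  have /= OA : nbhs x (W `&` cmap c @^-1` A).
    apply: filterI; first exact: open_nbhs_nbhs.
    by apply: (ccont x _ _ cA); exact: Oc.
  apply: filterS (orbit_proj_nbhs OA) => _ [y [Oy Ay] <-].
  by rewrite /preimage /= -[cmap c _]/(cmap (quotient_chart act W c) _) cE.
- move=> y; rewrite [X in X y]iE => -[x Ox <-].
  apply: continuous_comp; last exact: orbit_proj_continuous.
  by apply: ci; exists x => //; exact: Oc.
Qed.

(** The expression of [f] in a quotient chart is that of [f \o proj] in the chart upstairs. All
    points over [z] are considered because each quotient chart selects its own representative. *)
Lemma smooth_at_quotient (N : charted_space R) (f : Q -> N) (z : Q) :
  (forall x, proj x = z -> smooth_at (f \o proj) x) -> smooth_at f z.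
Proof.
move=> sf; split=> [A fA|_ c' [W [c [ac oO Oc iO ->]]] ac' [x Ox xz] c'x].
  have [x xz] := orbit_proj_surj z; rewrite -xz in fA *.
  have := (sf x xz).1 A fA => /= xA.
  by apply: filterS (orbit_proj_nbhs xA) => _ [y Ay <-].
subst z; have [_ /(_ c c' ac ac' (Oc _ Ox) c'x)] := sf x erefl.
by rewrite -{1}(orbit_sectionK iO Ox).
Qed.

(** In charts the projection reads as [act g], for a [g] moving [x] to the representative selected
    by the quotient chart. *)
Lemma smooth_at_orbit_proj x : @smooth_at R M Q (orbit_proj act) x.
Proof.
split; first exact: orbit_proj_continuous.
move=> k _ ak [W [c [ac oO Oc iO ->]]] kx [u Wu ux].
have /esym/orbit_projP[g gx] := ux; subst u.
have [_ /(_ k c ak ac kx (Oc _ Wu)) s] := sact g x.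
apply: smoothg_near s.
have sE := orbit_section_act oO iO Wu.
by apply: filterS (chart_nbhs (cM.2 _ ak) kx sE) => y [/= <-].
Qed.

Lemma smooth_at_orbit_section (W : set M) x : open W ->
  {in W &, injective (orbit_proj act)} -> W x -> smooth_at (orbit_section W) (proj x).
Proof.
move=> oW iW Wx; apply: smooth_at_quotient => y /orbit_projP[g gy]; subst x.
apply: smooth_at_near cM _ (sact g y).
by apply: filterS (orbit_section_act oW iW Wx) => y' ->.
Qed.

Lemma orbit_local_section (x : M) : exists s : Q -> M,
  [/\ smooth_at s (proj x), s (proj x) = x &
      {near proj x, (orbit_proj act : M -> Q) \o s =1 id}].
Proof.
have [W [oW Wx] iW] := loc_inj x.
exists (orbit_section W); split; last 1 first.
- have : nbhs (proj x) (proj @` W) by apply: orbit_proj_nbhs; exact: open_nbhs_nbhs.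
  by apply: filterS => _ [y Wy <-] /=; rewrite orbit_sectionK.
- exact: smooth_at_orbit_section.
- exact: orbit_sectionK.
Qed.

(** A point of the fibre is moved into [W] by some [g]; the section through it is the one with
    values in [W], translated by the inverse of [g]. *)
Lemma orbit_proj_sheeted : sheeted proj.
Proof.
move=> z; have [x0 <-] := orbit_proj_surj z.
have [W [oW Wx0] iW] := loc_inj x0.
exists (proj @` W).
  by split; [exact: orbit_proj_open|exists x0].
move=> x [u Wu /esym/orbit_projP[g gx]].
exists (act g^-1%g \o orbit_section W), (act g @^-1` W); split.
- split; last by rewrite /= gx.
  by apply: open_comp => // y _; exact: act_continuous.
- move=> _ [y Wy <-]; split.
    apply: continuous_comp; last exact: act_continuous.
    by have [] := smooth_at_orbit_section oW iW Wy.
  rewrite /= orbit_sectionK //; apply/esym/orbit_projP; by exists g^-1%g.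
- move=> y Wgy; have yE : proj y = proj (act g y) by apply/orbit_projP; exists g.
  split; first by exists (act g y).
  by rewrite /= yE orbit_sectionK // -actM mulVg act1.
Qed.

(** Pulling back further along a local section recovers the tensor. Hence at most one tensor
    satisfies the condition that defines [quotient_form]. *)
Lemma pullback_orbit_proj_inj (w w' : two_tensor Q) :
  pullback (orbit_proj act : M -> Q) w = pullback (orbit_proj act : M -> Q) w' -> w = w'.
Proof.
move=> ww'; apply/funext => z; have [x <-] := orbit_proj_surj z.
have [s [ss sx ps]] := orbit_local_section x.
have cQ := quotient_covered.
have sp : @smooth_at R M Q (orbit_proj act) (s (proj x)).
  by rewrite sx; exact: smooth_at_orbit_proj.
have E (v : two_tensor Q) : v (proj x) = pullback s (pullback (orbit_proj act : M -> Q) v) (proj x).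
  rewrite -pullback_comp //.
  have pss := smooth_at_comp cQ cM ss sp.
  by rewrite -(pullback_near v cQ cQ ps pss) pullback_id.
by rewrite (E w) (E w') ww'.
Qed.

End QuotientByGroup.

Lemma prod_hausdorff (T U : topologicalType) :
  hausdorff_space T -> hausdorff_space U -> hausdorff_space (T * U)%type.
Proof.
move=> hT hU [a b] [a' b'] cl; congr (_, _).
  apply: hT => A B aA a'B.
  have [[x y] [/= Ax Bx]] := cl (fst @^-1` A) (fst @^-1` B)
    (@cvg_fst _ _ (nbhs a) (nbhs b) _ A aA) (@cvg_fst _ _ (nbhs a') (nbhs b') _ B a'B).
  by exists x.
apply: hU => A B bA b'B.
have [[x y] [/= Ay By]] := cl (snd @^-1` A) (snd @^-1` B)
  (@cvg_snd _ _ (nbhs a) (nbhs b) _ A bA) (@cvg_snd _ _ (nbhs a') (nbhs b') _ B b'B).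
by exists y.
Qed.

(** * The bimodule and its sections *)

Section BimoduleStructure.
Context {R : realType} {Su S : charted_space R} (p : continuousType Su S) (m0 : Su).
Context (phi : {multiplicative pi1 R (p m0) -> pi1 R (p m0)}).
Context (sSu : smooth_manifold Su) (sS : smooth_manifold S).
Context (scSu : @simply_connected R Su) (pcov : smooth_covering p).
Notation I := (I01 R).
Notation G := (pi1 R (p m0)).
Notation M := (prod_manifold Su Su).
Notation act := (@bimodule_act R Su S p m0 phi).
Notation Q := (bimodule phi).
Notation proj := (orbit_proj act : M -> Q).
Notation left := (bimodule_left phi).
Notation right := (bimodule_right phi).

Let cSu := smooth_manifold_covered sSu.
Let cS := smooth_manifold_covered sS.
Let hSu : hausdorff_space Su. Proof. by case: sSu. Qed.
Let sp : sheeted p := covering_sheeted cSu cS pcov.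
Let cM : covered_by_charts M := prod_covered cSu cSu.
Let hM : hausdorff_space M := prod_hausdorff hSu hSu.

Let phi1 : phi 1%g = 1%g.
Proof. by apply: (@mulgI _ (phi 1%g)); rewrite -gmulfM !mulg1. Qed.

Lemma bimodule_act1 z : act 1%g z = z.
Proof.
by case: z => x y; rewrite /bimodule_act /= phi1 !(deck1 m0 cSu cS hSu scSu pcov).
Qed.

Lemma bimodule_actM g h z : act (g * h)%g z = act g (act h z).
Proof. by rewrite /bimodule_act /= gmulfM !(deckM cSu cS hSu scSu pcov). Qed.

Lemma bimodule_act_smooth g z : smooth_at (act g) z.
Proof.
apply: smooth_at_pair.
  apply: (@smooth_at_comp _ M Su Su fst (deck g)) => //; first exact: smooth_at_fst.
  exact: deck_smooth_at.
apply: (@smooth_at_comp _ M Su Su snd (deck (phi g))) => //; first exact: smooth_at_snd.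
exact: deck_smooth_at.
Qed.

(** A sheet in the first factor times all of [Su]: an element relating two points of it fixes the
    first component, so it is 1 by freeness, and its image under [phi] then fixes the second. *)
Lemma bimodule_loc_inj z :
  exists2 W : set M, open_nbhs z W & {in W &, injective (orbit_proj act)}.
Proof.
have [U [oU Uz] sU] := covering_section cSu cS pcov (p z.1).
have [g [V [[oV Vz] gU gV]]] := sU _ Uz.
exists (fst @^-1` V).
  by split => //; apply: open_comp => // y _; exact: cvg_fst.
move=> [x y] [x' y'] /set_mem /= Vx /set_mem /= Vx' /(orbit_projP bimodule_act1 bimodule_actM).
move=> [c]; rewrite /bimodule_act /= => -[cx cy].
have xx' : x = x'.
  by rewrite -(gV _ Vx).2 -(gV _ Vx').2 -cx (deck_proj cSu cS hSu scSu pcov).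
have c1 : c = 1%g by apply: (deck_free cSu cS hSu scSu pcov (m := x)); rewrite cx.
by rewrite xx' -cy c1 phi1 (deck1 m0 cSu cS hSu scSu pcov).
Qed.

Let projP := orbit_projP bimodule_act1 bimodule_actM.
Lemma bimodule_covered : covered_by_charts Q.
Proof.
exact: quotient_covered cM bimodule_act1 bimodule_actM bimodule_act_smooth bimodule_loc_inj.
Qed.

Let cQ : covered_by_charts Q := bimodule_covered.
Let smooth_proj := smooth_at_orbit_proj cM bimodule_act1 bimodule_actM bimodule_act_smooth.

Lemma bimodule_projE z : left (proj z) = p z.1 /\ right (proj z) = p z.2.
Proof.
rewrite /bimodule_left /bimodule_right.
have /projP[c <-] : proj z = proj (repr (proj z : orbit_space act)).
  by apply/esym; exact: reprK.
by rewrite /= !(deck_proj cSu cS hSu scSu pcov).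
Qed.

Lemma bimodule_left_smooth z : smooth_at left z.
Proof.
apply: (smooth_at_quotient bimodule_act1 bimodule_actM bimodule_act_smooth) => x _.
have -> : left \o proj = p \o fst by apply/funext => y; exact: (bimodule_projE y).1.
apply: (@smooth_at_comp _ M Su S fst p) => //; first exact: smooth_at_fst.
exact: covering_smooth_at.
Qed.

Lemma bimodule_right_smooth z : smooth_at right z.
Proof.
apply: (smooth_at_quotient bimodule_act1 bimodule_actM bimodule_act_smooth) => x _.
have -> : right \o proj = p \o snd by apply/funext => y; exact: (bimodule_projE y).2.
apply: (@smooth_at_comp _ M Su S snd p) => //; first exact: smooth_at_snd.
exact: covering_smooth_at.
Qed.

(* The right-hand side has the pullback that characterizes the quotient form. *)
Lemma bimodule_formE (w : two_tensor S) :
  bimodule_form phi w = fun z => pullback left w z - pullback right w z.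
Proof.
set w0 := fun z => _.
have pw0 : @pullback R M Q (orbit_proj act) w0 =
    prod_form (pullback p w) (opposite_form (pullback p w)).
  apply/funext => z; rewrite /prod_form.
  have -> : @pullback R M Q (orbit_proj act) w0 z =
    @pullback R M Q (orbit_proj act) (pullback left w) z -
    @pullback R M Q (orbit_proj act) (pullback right w) z.
    by rewrite /pullback /w0 mulmxBr mulmxBl.
  have EL : @pullback R M Q (orbit_proj act) (pullback left w) z =
      @pullback R M Su fst (pullback p w) z.
    transitivity (@pullback R M S (left \o orbit_proj act) w z).
      by apply/esym; exact: (pullback_comp w cM cQ cS (smooth_proj z) (bimodule_left_smooth _)).
    have -> : left \o orbit_proj act = p \o fst.
      by apply/funext => y; exact: (bimodule_projE y).1.
    exact: (@pullback_comp _ M Su S fst p w z cM cSu cS (smooth_at_fst z sSu)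
      (covering_smooth_at cSu cS pcov _)).
  have ER : @pullback R M Q (orbit_proj act) (pullback right w) z =
      @pullback R M Su snd (pullback p w) z.
    transitivity (@pullback R M S (right \o orbit_proj act) w z).
      by apply/esym; exact: (pullback_comp w cM cQ cS (smooth_proj z) (bimodule_right_smooth _)).
    have -> : right \o orbit_proj act = p \o snd.
      by apply/funext => y; exact: (bimodule_projE y).2.
    exact: (@pullback_comp _ M Su S snd p w z cM cSu cS (smooth_at_snd z sSu)
      (covering_smooth_at cSu cS pcov _)).
  apply: (etrans (congr2 (fun A B => A - B) EL ER)); congr (_ + _).
  by rewrite /pullback /opposite_form mulmxN mulNmx.
rewrite /bimodule_form /quotient_form; case: xgetP => [w1 _ /= pw1|/(_ w0)//].
apply: (pullback_orbit_proj_inj cM bimodule_act1 bimodule_actM bimodule_act_smooth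
  bimodule_loc_inj).
by rewrite pw1 pw0.
Qed.

Lemma pullback_bimodule_form (N : charted_space R) (i : N -> Q) (w : two_tensor S) x :
  covered_by_charts N -> smooth_at i x ->
  pullback i (bimodule_form phi w) x =
  pullback (left \o i) w x - pullback (right \o i) w x.
Proof.
move=> cN si.
rewrite (pullback_comp w cN cQ cS si (bimodule_left_smooth (i x))).
rewrite (pullback_comp w cN cQ cS si (bimodule_right_smooth (i x))).
by rewrite /pullback bimodule_formE mulmxBr mulmxBl.
Qed.

(* Lift [s \o l], for a loop [l] of class [c], to [Su * Su] from [(m0, n0)]: the first
   component is the lift of [l], so the endpoint is [(c m0, phi c n0)]; the second
   one is the lift of [Phi \o l] from [n0], which computes [pi1_map]. *)
Lemma section_outer_induced (s : S -> Q) (Phi : continuousType S S) :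
  continuous s -> left \o s =1 id -> right \o s =1 Phi -> outer_induced Phi phi.
Proof.
move=> cs ls rs.
(* Moving a representative by a deck transformation makes its first component [m0]. With the base
   path [pa] obtained from [n0], the map [phi] equals [pi1_map] exactly, so the conjugating element
   below is 1. *)
have [n0 sn0] : exists n0, s (p m0) = proj (m0, n0).
  have [[m n] mn] := orbit_proj_surj (s (p m0)).
  have pm : p m = p m0.
    by have := ls (p m0); rewrite /= -mn (bimodule_projE (m, n)).1.
  have [c cm] := deck_transitive m0 cSu cS hSu scSu pcov pm.
  exists (deck (phi c) n); rewrite -mn; apply/projP; exists c.
  by rewrite /bimodule_act /= cm.
have pn0 : p n0 = Phi (p m0).
  by rewrite -rs /= sn0 (bimodule_projE (m0, n0)).2.
have [a _] := scSu.1 m0 n0.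
have ca : continuous (p \o a) := @cts_fun _ _ _.
have a0 : (p \o a) zero = p m0 by rewrite /= path_zero.
have a1 : (p \o a) one = Phi (p m0) by rewrite /= path_one.
pose pa : {path I from p m0 to Phi (p m0)} := mk_path ca a0 a1.
exists pa, 1%g => c; rewrite mul1g invg1 mulg1.
have Ea : lift_end p pa m0 n0 by exists a.
pose l := repr c; have lc : pi1_class l = c by exact: pi1_reprK.
have csl : continuous (s \o l) by apply: continuous_o cs; exact: cts_fun.
have sQ := orbit_proj_sheeted cM bimodule_act1 bimodule_actM bimodule_act_smooth bimodule_loc_inj.
have [|b [cb b0 pb]] := @path_lifting R M Q (orbit_proj act) sQ hM (s \o l) (m0, n0) csl.
  by rewrite /= path_zero sn0.
(* [s \o l] is a loop, so the two ends of its lift lie in one orbit. *)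
have [d db] : exists d, act d (m0, n0) = b one.
  by apply/projP; rewrite pb /= path_one sn0.
have E1 : lift_end p l m0 (deck d m0).
  apply: (@lift_endI _ _ _ _ _ _ _ (fst \o b)).
  - by apply: continuous_o cb _; exact: continuous_fst.
  - by rewrite /= b0.
  - by rewrite /= -db.
  - by move=> t; rewrite /= -(bimodule_projE (b t)).1 pb; exact: ls.
have E2 : lift_end p (Phi \o l) n0 (deck (phi d) n0).
  apply: (@lift_endI _ _ _ _ _ _ _ (snd \o b)).
  - by apply: continuous_o cb _; exact: continuous_snd.
  - by rewrite /= b0.
  - by rewrite /= -db.
  - by move=> t; rewrite /= -(bimodule_projE (b t)).2 pb; exact: rs.
have cd : c = d.
  rewrite -lc -(pi1_reprK d).
  apply: (pi1_class_inj_lift scSu E1).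
  have := deck_base cSu cS hSu scSu pcov (repr d).
  by rewrite pi1_reprK.
rewrite -cd in E2.
(* The lift of a loop in [phi c] ends at the point [y] from which [pa] leads to [deck (phi c) n0].
   Following [pa], [Phi \o l] and [pa] backwards from [m0] reaches the same [y]. *)
have := deck_lift_end cSu cS hSu scSu pcov (repr (phi c)) a.
rewrite pi1_reprK => /(lift_end_concatP sp hSu)[y E3 E4].
rewrite -[LHS]pi1_reprK; apply: (pi1_class_inj_lift scSu E3).
apply: (lift_end_concat (lift_end_concat Ea E2)).
exact: lift_end_reverse (E4 : lift_end p pa y _).
Qed.

(** [F] lifts [Phi \o p] with [F m0] the endpoint of the lift of [lg] followed by [a]. Both sides of
    the equivariance lift the same map, so it is enough to compare them at [m0]. *)
Lemma equivariant_lift (Phi : continuousType S S) : outer_induced Phi phi ->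
  exists F : Su -> Su, [/\ continuous F, forall m, p (F m) = Phi (p m) &
    forall c m, F (deck c m) = deck (phi c) (F m)].
Proof.
move=> [a [g phiE]].
pose lg := repr g; have lgE : pi1_class lg = g by exact: pi1_reprK.
have [|m1 Em1] := @lift_end_total R _ _ p sp hSu (concat lg a) m0 (@cts_fun _ _ _).
  by rewrite path_zero.
have [n0 E1 E2] := lift_end_concatP sp hSu Em1.
have [|F [cF F0 pF]] := @map_lifting R _ _ _ p sp hSu (Phi \o p) m0 m1 scSu (covered_locally_path_connected cSu).
  by have [_ ->] := lift_end_proj Em1; rewrite path_one.
exists F; split => // c.
apply: (@unique_map_lift R _ _ _ p sp hSu _ _ m0 scSu).
- by apply: continuous_o cF; exact: deck_continuous.
- by apply: continuous_o cF _; exact: deck_continuous.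
- by move=> m; rewrite /= pF /= !(deck_proj cSu cS hSu scSu pcov) pF.
pose l := repr c; have lc : pi1_class l = c by exact: pi1_reprK.
have E3 : lift_end p (Phi \o l) m1 (F (deck c m0)).
  have [b pb] := deck_base cSu cS hSu scSu pcov l; rewrite lc in b pb.
  apply: (@lift_endI _ _ _ _ _ _ _ (F \o b)).
  - by apply: continuous_o cF; exact: cts_fun.
  - by rewrite /= path_zero.
  - by rewrite /= path_one.
  - by move=> t; rewrite /= pF /= pb.
have [|n2 E4] := @lift_end_total R _ _ p sp hSu (reverse a) (F (deck c m0)) (@cts_fun _ _ _).
  by rewrite pF /= (deck_proj cSu cS hSu scSu pcov) path_zero.
have [|n3 E5] := @lift_end_total R _ _ p sp hSu (reverse lg) n2 (@cts_fun _ _ _).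
  by have [_ ->] := lift_end_proj E4; rewrite path_one path_zero.
have -> : phi c = pi1_class (concat (concat lg (concat (concat a (Phi \o l)) (reverse a)))
                                    (reverse lg)).
  rewrite phiE -{1 2}lgE.
  rewrite -[RHS]pi1_mulE -[in RHS]pi1_mulE.
  congr (_ * _)%g.
  by rewrite -pi1_invE.
have [b pb] := Em1.
rewrite F0; apply/esym; apply: (deck_eq cSu cS hSu scSu pcov (a := b)).
(* The loop in [phi c] lifts from [m0] through [n0], [m1], [F (deck c m0)] and [n2] to [n3]; the
   path [p \o b], that is [lg] then [a], undoes the last two pieces and returns to
   [F (deck c m0)]. *)
apply: (@lift_end_concat _ _ _ _ _ _ _ _ _ _ n3).
  apply: lift_end_concat E5; apply: (lift_end_concat E1).
  by apply: lift_end_concat E4; exact: lift_end_concat E2 E3.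
apply: (@lift_end_eq _ _ _ _ (concat lg a)) => [t|]; first by rewrite -pb.
apply: (@lift_end_concat _ _ _ _ _ _ _ _ _ _ n2).
  by apply: lift_end_eq (lift_end_reverse E5) => t; exact: reverseK.
by apply: lift_end_eq (lift_end_reverse E4) => t; exact: reverseK.
Qed.

(** The graph of [F] descends: by equivariance the class of (m, F m) depends only on [p m]. An
    arbitrary set-theoretic section [h] therefore defines [s], and near each point it can be
    replaced by a smooth local section of [p]. *)
Lemma outer_induced_section (Phi : continuousType S S) : smooth_map Phi ->
  outer_induced Phi phi ->
  exists s : S -> Q, [/\ smooth_map s, left \o s =1 id & right \o s =1 Phi].
Proof.
move=> sPhi oPhi; have [F [cF pF eF]] := equivariant_lift oPhi.
have sF m : smooth_at F m.
  apply: (smooth_at_lift cSu cS pcov cSu); first exact: cF.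
  have -> : p \o F = Phi \o p by apply/funext.
  apply: smooth_at_comp => //; first exact: covering_smooth_at.
  by have /smooth_mapP := sPhi; apply.
have /choice[h ph] : forall y, exists m, p m = y by have [] := pcov.
pose s y := proj (h y, F (h y)).
have sE m : s (p m) = proj (m, F m).
  have [c cm] := deck_transitive m0 cSu cS hSu scSu pcov (ph (p m)).
  by apply/projP; exists c; rewrite /bimodule_act /= -eF cm.
exists s; split=> [|y|y]; last 2 first.
- by rewrite /= (bimodule_projE (_, _)).1 /= ph.
- by rewrite /= (bimodule_projE (_, _)).2 /= pF ph.
apply/smooth_mapP => // y.
have [U [oU Uy] sU] := covering_section cSu cS pcov y.
have Uh : U (p (h y)) by rewrite ph.
have [g [V [_ gU _]]] := sU _ Uh.
have [sg _] := gU y Uy.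
apply: (@smooth_at_near _ S Q (fun y => proj (g y, F (g y)))) => //.
  have nU : nbhs y U by exact: open_nbhs_nbhs.
  by apply: filterS nU => y' /gU[_ pg]; rewrite -sE pg.
apply: (@smooth_at_comp _ S M Q (fun y => (g y, F (g y))) (orbit_proj act)) => //.
apply: smooth_at_pair => //.
by apply: smooth_at_comp; [| |exact: sg|exact: sF].
Qed.

(** The left map is a smooth left inverse of [s], which gives injectivity of [s] and of its
    differentials as well as the subspace topology. *)
Lemma section_bisection_by (s : S -> Q) (Phi : S -> S) : smooth_map s -> left \o s =1 id ->
  right \o s =1 Phi -> diffeomorphism Phi -> bisection_by left right (range s) s.
Proof.
move=> ss ls rs dPhi.
have sE : left \o s = id by apply/funext.
split=> //.
- split=> // [x|x y xy|U oU].
  + have /(smooth_mapP _ cS cQ) /(_ x) sx := ss.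
    have := mdiff_comp cS cQ cS sx (bimodule_left_smooth (s x)).
    rewrite sE mdiff_id // => E.
    by apply/row_freeP; exists (mdiff left (s x)).
  + by rewrite -[x]ls /= xy [LHS]ls.
  + exists (left @^-1` U); last by rewrite -comp_preimage sE.
    by apply: open_comp => // z _; apply: smooth_at_continuous; exact: bimodule_left_smooth.
- rewrite sE; split; first exact: smooth_map_id.
  by exists id; split => //; exact: smooth_map_id.
- by have -> : right \o s = Phi by apply/funext.
Qed.

(** With [g] the inverse of [left \o i], the section is [i \o g] and [Phi] is [right \o i \o g]. The
    last clause is conditional so that one [Phi] serves both equivalences. *)
Lemma bisection_outer_induced (Sigma : set Q) (N : charted_space R) (i : N -> Q) :
  bisection_by left right Sigma i ->
  exists Phi : continuousType S S, [/\ diffeomorphism Phi, outer_induced Phi phi &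
    forall w, (forall x, pullback i (bimodule_form phi w) x = 0) -> pullback Phi w = w].
Proof.
move=> [sN [si _ _ _] _ [sli [g [sg gK Kg]]] [sri [h [sh hK Kh]]]].
have cN := smooth_manifold_covered sN.
have sPhi : smooth_map (right \o i \o g) by apply: smooth_map_comp.
pose PhiC := isContinuous.Build S S (right \o i \o g) (smooth_map_continuous sPhi).
pose Phi : continuousType S S := HB.pack (right \o i \o g) PhiC.
exists Phi; split.
- split=> //; exists (left \o i \o h); split; first exact: smooth_map_comp.
  + by move=> x; rewrite /= (hK (g x)); exact: Kg.
  + by move=> x; rewrite /= (gK (h x)); exact: Kh.
- apply: (@section_outer_induced (i \o g)) => //.
  apply: continuous_o; exact: smooth_map_continuous.
- move=> w lag; apply/funext => x.
  have six y : smooth_at i y by have /smooth_mapP := si; apply.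
  have sgx : smooth_at g x by have /smooth_mapP := sg; apply.
  have E y : pullback (right \o i) w y = pullback (left \o i) w y.
    by apply/esym/eqP; rewrite -subr_eq0 -pullback_bimodule_form // lag.
  have sl : smooth_at (left \o i) (g x) by have /smooth_mapP := sli; apply.
  have sr : smooth_at (right \o i) (g x) by have /smooth_mapP := sri; apply.
  (* The pullback of [w] by [Phi] is that by [right \o i] followed by [g]; [E] turns right into
     left, and [left \o i \o g] is the identity. *)
  rewrite (pullback_comp w cS cN cS sgx sr).
  rewrite {1}/pullback E -[LHS]/(pullback g (pullback (left \o i) w) x).
  rewrite -(pullback_comp w cS cN cS sgx sl).
  have -> : (left \o i) \o g = id by apply/funext.
  exact: pullback_id.
Qed.

End BimoduleStructure.

Theorem proposition5p6 (R : realType) (S Su : charted_space R)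
    (w : two_tensor S) (p : continuousType Su S) (m0 : Su)
    (phi : {multiplicative pi1 R (p m0) -> pi1 R (p m0)}) :
  smooth_manifold S -> connected [set: S] -> symplectic_form w ->
  universal_covering p ->
  bijective phi ->
  ((exists Sigma : set (bimodule phi),
      bisection (bimodule_left phi) (bimodule_right phi) Sigma) <->
   (exists Phi : continuousType S S,
      diffeomorphism Phi /\ outer_induced Phi phi)) /\
  ((exists Sigma : set (bimodule phi),
      lagrangian_bisection (bimodule_left phi) (bimodule_right phi)
                           (bimodule_form phi w) Sigma) <->
   (exists Phi : continuousType S S,
      symplectomorphism w w Phi /\ outer_induced Phi phi)).
Proof.
move=> sS _ _ [sSu scSu pcov] _.
have cS := smooth_manifold_covered sS.
split; split.
- move=> [Sigma [N [i bi]]].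
  by have [Phi [dPhi oPhi _]] := bisection_outer_induced sSu sS scSu pcov bi; exists Phi.
- move=> [Phi [dPhi oPhi]].
  have [s [ss ls rs]] := outer_induced_section sSu sS scSu pcov dPhi.1 oPhi.
  exists (range s), S, s.
  exact: section_bisection_by ls rs dPhi.
- move=> [Sigma [N [i [bi lag]]]].
  have [Phi [dPhi oPhi wPhi]] := bisection_outer_induced sSu sS scSu pcov bi.
  by exists Phi; split => //; split => //; exact: wPhi.
- move=> [Phi [[dPhi wPhi] oPhi]].
  have [s [ss ls rs]] := outer_induced_section sSu sS scSu pcov dPhi.1 oPhi.
  have cQ := bimodule_covered phi sSu sS scSu pcov.
  exists (range s), S, s; split; first exact: section_bisection_by ls rs dPhi.
  move=> x; have /(smooth_mapP _ cS cQ)/(_ x) sx := ss.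
  rewrite (pullback_bimodule_form sSu sS scSu pcov w cS sx).
  have -> : bimodule_left phi \o s = id by apply/funext.
  have -> : bimodule_right phi \o s = Phi by apply/funext.
  by rewrite pullback_id // wPhi subrr.
Qed.
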